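(* Let $\nu=\beta+(s^s)+\alpha$ be a partition of type 2 (with this decomposition) such that $\beta_1=1$. Then $\mu=\beta+(s^s,1)+\alpha$ covers $\nu$.
   Context: Sums of partitions are componentwise (padding with zeros). $(s^s)$ is the partition with $s$ parts equal to $s$; $(s^s,1)$ is $(s^s)$ followed by a part $1$. $\lambda'$ is the conjugate, $|\lambda|$ the size, $\ell(\lambda)$ the number of nonzero parts, $\mu\subseteq\lambda$ means $\mu_i\le\lambda_i$ for all $i$. For $\mu\subseteq(m^m)$, $\mu^c=(m-\mu_m,\dots,m-\mu_1)$ is its complement in $(m^m)$. A symmetric function is Schur-positive if all its Schur coefficients are nonnegative. For partitions $\nu\subseteq\mu$ with $|\mu|=|\nu|+1$, $\mu$ covers $\nu$ if $s_{\mu'}s_{\mu^c}-s_{\nu'}s_{\nu^c}$ is Schur-positive, both complements in the same square $(m^m)$ with $m\ge\mu_1+\ell(\mu)$. A partition $\nu$ is of type 2 if $\nu=\beta+(s^s)+\alpha$ where $s\ge1$, $\alpha$ is a nonempty partition, and $\beta$ is a (possibly empty) partition which, with $i=\beta_1\ge0$, contains $(i^{s+1},i,i-1,\dots,2,1)$ (that is, $s+2$ parts equal to $i$ followed by $i-1,\dots,1$).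
   Formalization: The formal theorem also assumes that α has at most s parts (α lies to the right of the square (s^s)); without this the claim fails, e.g. s=1, β=(1,1,1), α=(1,1), ν=(3,2,1), μ=(3,3,1), m=6. *)

(* Defs.v *)
From mathcomp Require Import all_boot all_order all_algebra.
From mathcomp Require Import mpoly.

Set Implicit Arguments.
Unset Strict Implicit.
Unset Printing Implicit Defensive.

Import GRing.Theory Num.Theory.

Local Open Scope nat_scope.

(* A partition is the sequence of its nonzero parts in weakly decreasing order:
   [size la] is its length, [sumn la] its size, and [nth 0 la i] its (i+1)-st
   part, which is 0 for [i >= size la]. *)
Definition is_part (la : seq nat) : bool := sorted geq la && (0 \notin la).

Definition part_add (la mu : seq nat) : seq nat :=
  mkseq (fun i => nth 0 la i + nth 0 mu i) (maxn (size la) (size mu)).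

Definition part_conj (la : seq nat) : seq nat :=
  mkseq (fun j => count (fun p => j < p) la) (head 0 la).

Definition part_sub (mu la : seq nat) : Prop :=
  forall i : nat, nth 0 mu i <= nth 0 la i.

(* Only meaningful for [mu] contained in (m^m); zero parts are dropped. *)
Definition part_compl (m : nat) (mu : seq nat) : seq nat :=
  [seq p <- rev (mkseq (fun i => m - nth 0 mu i) m) | p != 0].

Definition cell (la : seq nat) : finType :=
  {c : 'I_(size la) * 'I_(head 0 la) | c.2 < nth 0 la c.1}.

Definition is_ssyt (la : seq nat) (n : nat) (T : {ffun cell la -> 'I_n}) :
    bool :=
  [forall c : cell la, forall d : cell la,
     (((val c).1 == (val d).1) && ((val c).2 < (val d).2) ==> (T c <= T d))
  && (((val c).2 == (val d).2) && ((val c).1 < (val d).1) ==> (T c < T d))].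

(* A symmetric function with integer coefficients is represented by its images
   in n variables, obtained by setting all but the first n variables to 0, for
   every n. *)
Definition symfun : Type := forall n : nat, {mpoly int[n]}.

Definition schur (la : seq nat) : symfun := fun n =>
  (\sum_(T : {ffun cell la -> 'I_n} | is_ssyt T)
     \prod_(c : cell la) 'X_(T c))%R.

(* The coefficients do not depend on n; as the Schur functions form a basis,
   they are the Schur coefficients of f. *)
Definition schur_expansion (f : symfun) (s : seq (seq nat))
    (a : seq nat -> int) : Prop :=
  [/\ uniq s, all is_part s &
      forall n : nat, f n = (\sum_(la <- s) a la *: schur la n)%R].

Definition schur_positive (f : symfun) : Prop :=
  exists (s : seq (seq nat)) (a : seq nat -> int),
    schur_expansion f s a /\ {in s, forall la, (0 <= a la)%R}.

(* s_(mu') s_(mu^c) - s_(nu') s_(nu^c), with complements in (m^m) *)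
Definition cover_diff (m : nat) (mu nu : seq nat) : symfun := fun n =>
  (schur (part_conj mu) n * schur (part_compl m mu) n
   - schur (part_conj nu) n * schur (part_compl m nu) n)%R.

Definition covers (mu nu : seq nat) : Prop :=
  [/\ is_part mu, is_part nu, part_sub nu mu, sumn mu = (sumn nu).+1 &
      forall m : nat, head 0 mu + size mu <= m ->
        schur_positive (cover_diff m mu nu)].

(* (i^(s+1), i, i-1, ..., 2, 1); for i = 0 it only has zero parts. *)
Definition stair (i s : nat) : seq nat := nseq s.+1 i ++ rev (iota 1 i).

Definition type2_decomp (nu beta : seq nat) (s : nat) (alpha : seq nat) :
    Prop :=
  [/\ is_part beta /\ is_part alpha, 1 <= s, alpha <> [::],
      part_sub (stair (head 0 beta) s) beta &
      nu = part_add (part_add beta (nseq s s)) alpha].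

(* Main.v *)
(** Write A for the conjugate of nu and B for its complement in (m^m); passing
    from nu to mu adds a box to the second row of A and removes one from the row
    m - s of B. A version of the Littlewood-Richardson rule, valid because the
    last row of B is at least as long as the first row of A, expands s_A s_B
    over the chains delta = u^0 <= u^1 <= ... <= u^m = A of horizontal strips
    such that writing, for every t, the row indices of the boxes of u^t/u^(t-1)
    in increasing order behind row t of B gives strictly increasing columns; the
    chain u contributes the Schur function of (B + (|u^t/u^(t-1)|)_t, delta).
    The rule is proved by letting Stembridge's sign-reversing involution act on
    Gelfand-Tsetlin patterns, with the variables reordered so that those indexed
    by the parts of delta come first.

    The chains for nu inject into those for mu. Since beta = (1^b) with
    b >= s + 2, the step m - s of a chain never uses the first row of A. If the
    first row is used again at some later step, the first of these boxes is
    moved to the step m - s and replaced by a box in the second row; otherwise a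
    box of the second row is added at the step m - s. Since alpha is nonempty, A
    has more than s + 1 rows, and this is what keeps the columns strict in the
    second case. *)

Require Import Defs.
From mathcomp Require Import all_boot all_order all_algebra all_fingroup.
From mathcomp Require Import mpoly zify.

Set Implicit Arguments.
Unset Strict Implicit.
Unset Printing Implicit Defensive.

Import GRing.Theory Num.Theory.

Local Open Scope nat_scope.

(** * Bender-Knuth flips of chains of horizontal strips *)

(** The rows of a Gelfand-Tsetlin pattern: interlacing means that the shape [h t.+1] arises from
    [h t] by adding a horizontal strip. *)
Definition strips (n : nat) (h : nat -> nat -> nat) : Prop :=
  forall t i, t < n -> h t.+1 i.+1 <= h t i /\ h t i <= h t.+1 i.

Definition rsum (h : nat -> nat -> nat) (t i : nat) : nat := \sum_(j < i) h t j.

(** The letters [t] in the first [i] rows; for large [i] this is the exponent of the variable with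
    index [t]. *)
Definition wt (h : nat -> nat -> nat) (t i : nat) : nat :=
  \sum_(j < i) (h t.+1 j - h t j).

Lemma rsum0 h t : rsum h t 0 = 0. Proof. by rewrite /rsum big_ord0. Qed.

Lemma rsumS h t i : rsum h t i.+1 = rsum h t i + h t i.
Proof. by rewrite /rsum big_ord_recr. Qed.

Lemma wt0 h t : wt h t 0 = 0. Proof. by rewrite /wt big_ord0. Qed.

Lemma wtS h t i : wt h t i.+1 = wt h t i + (h t.+1 i - h t i).
Proof. by rewrite /wt big_ord_recr. Qed.

Lemma wt_rsum n h t i : strips n h -> t < n ->
  rsum h t i + wt h t i = rsum h t.+1 i.
Proof.
move=> sh lt_t; elim: i => [|i IH]; first by rewrite !rsum0 wt0.
by rewrite !rsumS wtS; have [_] := sh t i lt_t; lia.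
Qed.

Lemma strips_mono m u t t' i : strips m u -> t <= t' -> t' <= m ->
  u t i <= u t' i.
Proof.
move=> su /subnK <-; elim: (t' - t) => [|d IH] // dm.
by have := IH (ltnW dm); have [_] := su (d + t) i dm; rewrite addSn; lia.
Qed.

Lemma eq_wt h h' t i :
  (forall j, j < i -> h t j = h' t j /\ h t.+1 j = h' t.+1 j) ->
  wt h t i = wt h' t i.
Proof. by move=> e; apply: eq_bigr => j _; have [-> ->] := e j (ltn_ord j). Qed.

Lemma leq_wt h t i i' : i <= i' -> wt h t i <= wt h t i'.
Proof.
move=> /subnK <-; elim: (i' - i) => [|d IH] //.
by rewrite addSn wtS; lia.
Qed.

(** For fixed rows [k] and [k.+2], interlacing confines [h k.+1 j] to the interval from [lower] to
    [upper]. [flip] takes [upper] only at [j > i], where [j.-1] is a genuine predecessor. *)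
Definition upper (h : nat -> nat -> nat) (k j : nat) : nat :=
  minn (h k.+2 j) (h k j.-1).

Definition lower (h : nat -> nat -> nat) (k j : nat) : nat :=
  maxn (h k.+2 j.+1) (h k j).

(* A chain [h] encodes the tableau whose letters less than [t] fill the shape
   [h t]. For [i = 0] and [u = h k.+2 0], [flip] is the Bender-Knuth involution
   on the letters [k] and [k.+1]; in general the columns of row [i] beyond [u],
   and the rows before [i], are frozen. *)
Definition flip (h : nat -> nat -> nat) (k i u t j : nat) : nat :=
  if t == k.+1 then
    if j < i then h t j
    else (if j == i then u else upper h k j) + lower h k j - h t j
  else h t j.

Definition flippable (h : nat -> nat -> nat) (k i u : nat) : Prop :=
  [/\ h k.+1 i <= u, u <= h k.+2 i & 0 < i -> u <= h k i.-1].

Lemma flip_neq h k i u t j : t != k.+1 -> flip h k i u t j = h t j.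
Proof. by rewrite /flip => /negPf->. Qed.

Lemma flip_lt h k i u t j : j < i -> flip h k i u t j = h t j.
Proof. by rewrite /flip => ->; case: ifP. Qed.

Lemma flip_bounds n h k i u j : strips n h -> k.+1 < n -> flippable h k i u ->
  i <= j -> lower h k j <= flip h k i u k.+1 j /\
    flip h k i u k.+1 j <= (if j == i then u else upper h k j).
Proof.
move=> sh kn [h1 h2 h3] ij; rewrite /flip eqxx ltnNge ij /=.
have [a1 a2] := sh k.+1 j kn; have [b1 b2] := sh k j (ltnW kn).
have c1 := sh k j.-1 (ltnW kn); rewrite /lower /upper.
have [ei|ne] := eqVneq j i; first by subst j; lia.
have jE : j.-1.+1 = j by lia.
by move: c1; rewrite jE => -[c1 c2]; lia.
Qed.

Lemma flip_strips n h k i u : strips n h -> k.+1 < n -> flippable h k i u ->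
  strips n (flip h k i u).
Proof.
move=> sh kn fl t j tn; have [a1 a2] := sh t j tn.
have [e1|n1] := eqVneq t.+1 k.+1.
  have e2 : t = k by lia.
  subst t; rewrite [flip _ _ _ _ k _]flip_neq ?[flip _ _ _ _ k _]flip_neq; try lia.
  have [ji|ij] := ltnP j i.
    rewrite [X in _ /\ _ <= X]flip_lt //; split => //.
    have [j1|j1] := ltnP j.+1 i; first by rewrite flip_lt.
    have [_ +] := flip_bounds sh kn fl j1; case: fl => _ _ u1.
    by case: eqP => [ei|ni]; last lia; subst i => /leq_trans; apply; apply: u1.
  have [b1 _] := flip_bounds sh kn fl ij.
  have [_] := flip_bounds sh kn fl (leqW ij).
  rewrite ifF; last lia; move: b1; rewrite /lower /upper /=; lia.
have [e2|n2] := eqVneq t k.+1; last by rewrite !flip_neq.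
subst t; rewrite [flip _ _ _ _ k.+2 _]flip_neq; last lia.
rewrite [flip _ _ _ _ k.+2 _]flip_neq; last lia.
have [ji|ij] := ltnP j i; first by rewrite flip_lt.
have [b1 b2] := flip_bounds sh kn fl ij; case: fl => h1 h2 h3.
move: b1 b2; rewrite /lower /upper; case: eqP => [->|]; lia.
Qed.

(** The flip reflects row [k.+1] in intervals whose ends depend on [u] and on rows [k] and [k.+2],
    which it leaves in place. *)
Lemma flipK n h k i u t j : strips n h -> k.+1 < n -> flippable h k i u ->
  flip (flip h k i u) k i u t j = h t j.
Proof.
move=> sh kn fl; have [et|nt] := eqVneq t k.+1; last by rewrite !flip_neq.
subst t; have [ji|ij] := ltnP j i; first by rewrite !flip_lt.
have [b1 b2] := flip_bounds sh kn fl ij.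
rewrite {1}/flip eqxx ltnNge ij /= /lower /upper.
rewrite ![flip _ _ _ _ k _]flip_neq ?[flip _ _ _ _ k _]flip_neq; try lia.
rewrite ![flip _ _ _ _ k.+2 _]flip_neq ?[flip _ _ _ _ k.+2 _]flip_neq; try lia.
rewrite -/(lower h k j) -/(upper h k j); set x := if _ then _ else _.
rewrite -/x in b2.
have E : flip h k i u k.+1 j = x + lower h k j - h k.+1 j.
  by rewrite /flip eqxx ltnNge ij /= /x; case: ifP.
have : h k.+1 j <= x.
  have [a1 a2] := sh k.+1 j kn; have [c1 c2] := sh k j (ltnW kn).
  rewrite /x; case: fl; case: eqP => [->|ne] // _ _ _.
  have := sh k j.-1 (ltnW kn).
  have -> : j.-1.+1 = j by lia.
  rewrite /upper; lia.
have : lower h k j <= h k.+1 j.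
  have [a1 a2] := sh k.+1 j kn; have [c1 c2] := sh k j (ltnW kn).
  rewrite /lower; lia.
lia.
Qed.

(* [upper h k j.+1 + lower h k j] is a sum of a minimum and a maximum of the
   same two numbers, so the rows telescope. *)
Lemma flip_rsum_aux n h k i u d : strips n h -> k.+1 < n -> flippable h k i u ->
  rsum (flip h k i u) k.+1 (i.+1 + d) + rsum h k.+1 (i.+1 + d)
    + rsum h k i + rsum h k.+2 i.+1 =
  (rsum h k.+1 i).*2 + u + rsum h k (i + d) + rsum h k.+2 (i.+1 + d)
    + lower h k (i + d).
Proof.
move=> sh kn fl.
have le_lo j : lower h k j <= h k.+1 j.
  have [a1 a2] := sh k.+1 j kn; have [c1 c2] := sh k j (ltnW kn).
  rewrite /lower; lia.
elim: d => [|d IH].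
  rewrite !addn0 !rsumS.
  have -> : rsum (flip h k i u) k.+1 i = rsum h k.+1 i.
    by apply: eq_bigr => j _; rewrite flip_lt.
  rewrite /flip eqxx ltnn eqxx /=; case: fl => h1 h2 h3; have := le_lo i; lia.
rewrite !addnS !addSn !rsumS.
have [i1 i2]: i < (i + d).+1 /\ (i <= i + d) by lia.
have E : flip h k i u k.+1 (i + d).+1
   = upper h k (i + d).+1 + lower h k (i + d).+1 - h k.+1 (i + d).+1.
  by rewrite /flip eqxx ltnNge (ltnW i1) /= ifF //; lia.
rewrite E; have := le_lo (i + d).+1.
have : h k.+1 (i + d).+1 <= upper h k (i + d).+1.
  have [a1 a2] := sh k.+1 (i+d).+1 kn; have [c1 c2] := sh k (i+d) (ltnW kn).
  rewrite /upper /=; lia.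
move: (lower h k (i + d).+1) IH => lw; rewrite !addSn !rsumS.
have -> : upper h k (i + d).+1 = minn (h k.+2 (i + d).+1) (h k (i + d)) by [].
rewrite /lower; lia.
Qed.

Lemma flip_zero n h k i u L : strips n h -> k.+1 < n -> flippable h k i u ->
  i < L -> (forall t j, L <= j -> h t j = 0) ->
  forall t j, L <= j -> flip h k i u t j = 0.
Proof.
move=> sh kn fl iL hz t j Lj; have [->|nt] := eqVneq t k.+1; last first.
  by rewrite flip_neq ?hz.
have [_] := flip_bounds sh kn fl (leq_trans (ltnW iL) Lj).
rewrite ifF; last lia; rewrite /upper (hz k.+2 j Lj); lia.
Qed.

Lemma flip_rsum n h k i u L : strips n h -> k.+1 < n -> flippable h k i u ->
  i < L -> (forall t j, L <= j -> h t j = 0) ->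
  rsum (flip h k i u) k.+1 L + rsum h k.+1 L + rsum h k i + rsum h k.+2 i.+1 =
  (rsum h k.+1 i).*2 + u + rsum h k L + rsum h k.+2 L.
Proof.
move=> sh kn fl iL hz; have := flip_rsum_aux (L - i.+1) sh kn fl.
have -> : i.+1 + (L - i.+1) = L by lia.
(* Row [L] is empty, so [lower] in the last row is the last summand of this row sum. *)
have -> : rsum h k L = rsum h k (i + (L - i.+1)) + h k (i + (L - i.+1)).
  by rewrite -rsumS; congr rsum; lia.
rewrite /lower hz; lia.
Qed.

Lemma flip_wt_neq h k i u t l : t != k -> t != k.+1 ->
  wt (flip h k i u) t l = wt h t l.
Proof. by move=> h1 h2; apply: eq_wt => j _; rewrite !flip_neq. Qed.

Lemma flip_wt_le h k i u t l : l <= i -> wt (flip h k i u) t l = wt h t l.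
Proof. by move=> h1; apply: eq_wt => j jl; rewrite !flip_lt //; lia. Qed.

(** Nothing is frozen, so the old and the new row sum of [k.+1] add up to those of rows [k] and
    [k.+2]; this exchanges the numbers of the two letters. *)
Lemma flip0_wt n h k L : strips n h -> k.+1 < n -> 0 < L ->
  (forall t j, L <= j -> h t j = 0) ->
  wt (flip h k 0 (h k.+2 0)) k L = wt h k.+1 L /\
  wt (flip h k 0 (h k.+2 0)) k.+1 L = wt h k L.
Proof.
move=> sh kn L0 hz.
have fl : flippable h k 0 (h k.+2 0).
  by split => //; have [] := sh k.+1 0 kn.
have := flip_rsum sh kn fl L0 hz; rewrite !rsumS !rsum0.
have sf := flip_strips sh kn fl; set f := flip _ _ _ _ in sf *.
have := wt_rsum L sf kn; have := wt_rsum L sf (ltnW kn).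
have := wt_rsum L sh kn; have := wt_rsum L sh (ltnW kn).
have -> : rsum f k L = rsum h k L by apply: eq_bigr => j _; rewrite /f flip_neq; lia.
have -> : rsum f k.+2 L = rsum h k.+2 L
  by apply: eq_bigr => j _; rewrite /f flip_neq; lia.
lia.
Qed.

(** With [g] a partition plus the staircase of exponents, the absence of bad places is the
    Littlewood-Richardson condition, stated for the partition alone in [lattice]. *)
Definition bad (g : nat -> nat) (h : nat -> nat -> nat) (k i : nat) : bool :=
  g k + wt h k i <= g k.+1 + wt h k.+1 i.+1.

(** Read row [i] from its right end: after the letters [k.+1] beyond this column, both letters,
    counted with [g] and all earlier rows, are equally frequent. *)
Definition cut (g : nat -> nat) (h : nat -> nat -> nat) (k i : nat) : nat :=
  h k.+2 i + g k.+1 + wt h k.+1 i - (g k + wt h k i).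

(** Badness at [i] bounds the cut from below, its failure at [i.-1] bounds it from above; for
    [i = 0] the inequality between the values of [g] takes that role. *)
Lemma cut_flippable n g h k i : strips n h -> k.+1 < n -> g k.+1 < g k ->
  bad g h k i -> (0 < i -> ~~ bad g h k i.-1) -> flippable h k i (cut g h k i).
Proof.
rewrite /bad /cut => sh kn gk; rewrite wtS.
have [a1 a2] := sh k.+1 i kn; case: i => [|i] in a1 a2 *.
  by rewrite !wt0 /flippable => b _; split; lia.
move=> b /(_ isT); move: b; rewrite /= !wtS => b nb; have [c1 c2] := sh k i (ltnW kn).
have [d1 d2] := sh k.+1 i kn.
split=> [||_]; rewrite ?succnK; lia.
Qed.

Lemma cut_wt n g h k i L : strips n h -> k.+1 < n -> i < L ->
  (forall t j, L <= j -> h t j = 0) -> bad g h k i ->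
  flippable h k i (cut g h k i) ->
  g k + wt (flip h k i (cut g h k i)) k L = g k.+1 + wt h k.+1 L /\
  g k.+1 + wt (flip h k i (cut g h k i)) k.+1 L = g k + wt h k L.
Proof.
move=> sh kn iL hz bd fl.
have := flip_rsum sh kn fl iL hz.
have sf := flip_strips sh kn fl; set f := flip _ _ _ _ in sf *.
have := wt_rsum L sf kn; have := wt_rsum L sf (ltnW kn).
have := wt_rsum L sh kn; have := wt_rsum L sh (ltnW kn).
have := wt_rsum i sh kn; have := wt_rsum i sh (ltnW kn).
have -> : rsum f k L = rsum h k L by apply: eq_bigr => j _; rewrite /f flip_neq; lia.
have -> : rsum f k.+2 L = rsum h k.+2 L
  by apply: eq_bigr => j _; rewrite /f flip_neq; lia.
rewrite /cut !rsumS; move: bd; rewrite /bad wtS.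
have [a1 a2] := sh k.+1 i kn; lia.
Qed.

Lemma cut_flip g h k i u : cut g (flip h k i u) k i = cut g h k i.
Proof. by rewrite /cut !flip_wt_le // flip_neq //; lia. Qed.

Lemma bad_flip_prev g h k i u t j :
  (j < i) || ((j == i) && (k < t)) -> bad g (flip h k i u) t j = bad g h t j.
Proof.
move=> ji; rewrite /bad.
have [lt_ji|le_ij] := ltnP j i; first by rewrite !flip_wt_le //; lia.
have [-> lt_kt]: j = i /\ k < t by move: ji; lia.
by rewrite [wt _ t i]flip_wt_le // [wt _ t.+1 _]flip_wt_neq //; lia.
Qed.

(** After the flip, row [i] of shape [k.+1] still ends at or before the cut, so the letters [k.+1]
    that produce the balance are still there. *)
Lemma bad_flip n g h k i : strips n h -> k.+1 < n -> bad g h k i ->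
  flippable h k i (cut g h k i) -> bad g (flip h k i (cut g h k i)) k i.
Proof.
move=> sh kn bd fl; have [_] := flip_bounds sh kn fl (leqnn i).
have sf := flip_strips sh kn fl.
rewrite eqxx /bad wtS !flip_wt_le // [flip _ _ _ _ k.+2 _]flip_neq; last lia.
move: bd; rewrite /bad wtS => bd; case: fl => h1 h2 h3.
have [_ a2] := sh k.+1 i kn; rewrite {2}/cut; lia.
Qed.

(** * Tableaux as chains of partitions *)

(** Bounding the entries by [K] gives a finite type for sums to run over; [mk] is faithful only to
    values at most [K]. *)
Notation array n L K := {ffun 'I_n.+1 * 'I_L -> 'I_K.+1}.

(* Zero outside the index range. *)
Definition ev n L K (g : array n L K) (t i : nat) : nat :=
  match insub t, insub i with Some t', Some i' => g (t', i') | _, _ => 0 end.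

Definition mk n L K (h : nat -> nat -> nat) : array n L K :=
  [ffun p : 'I_n.+1 * 'I_L => inord (h p.1 p.2)].

Lemma ev_mk n L K h t i : t <= n -> i < L -> h t i <= K ->
  ev (mk n L K h) t i = h t i.
Proof.
move=> tn iL hK; have tn1 : t < n.+1 by [].
rewrite /ev (insubT (fun x => x < n.+1) tn1) (insubT (fun x => x < L) iL).
by rewrite ffunE /= inordK.
Qed.

Lemma ev_out n L K (g : array n L K) t i : L <= i -> ev g t i = 0.
Proof. by move=> Li; rewrite /ev [insub i]insubF ?ltnNge ?Li //; case: insub. Qed.

Lemma ev_le n L K (g : array n L K) t i : ev g t i <= K.
Proof.
by rewrite /ev; do 2!case: insubP => [? _ _|_] //; rewrite -ltnS ltn_ord.
Qed.

Lemma ev_inj n L K (g g' : array n L K) :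
  (forall t i, t <= n -> i < L -> ev g t i = ev g' t i) -> g = g'.
Proof.
move=> e; apply/ffunP => -[t i]; apply/val_inj.
have := e t i; rewrite -ltnS ltn_ord ltn_ord => /(_ isT isT).
by rewrite /ev !valK.
Qed.

Definition chain n L (la : nat -> nat) (h : nat -> nat -> nat) : bool :=
  [forall t : 'I_n, forall i : 'I_L,
     (h t.+1 i.+1 <= h t i) && (h t i <= h t.+1 i)] &&
  [forall i : 'I_L, (h n i == la i) && (h 0 i.+1 <= h 0 i)].

Lemma chainP n L la h : (forall t i, L <= i -> h t i = 0) ->
  (forall i, L <= i -> la i = 0) ->
  reflect [/\ strips n h, forall i, h n i = la i & forall i, h 0 i.+1 <= h 0 i]
          (chain n L la h).
Proof.
move=> hz lz; apply: (iffP andP) => [[/forallP h1 /forallP h2]|[h1 h2 h3]].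
  split=> [t i tn|i|i].
  - have [Li|iL] := leqP L i; first by rewrite !hz; lia.
    by have /forallP/(_ (Ordinal iL))/= := h1 (Ordinal tn); lia.
  - have [Li|iL] := leqP L i; first by rewrite !hz ?lz.
    by have /= := h2 (Ordinal iL); lia.
  - have [Li|iL] := leqP L i; first by rewrite !hz; lia.
    by have /= := h2 (Ordinal iL); lia.
split; last by apply/forallP => i; rewrite h2 h3 eqxx.
by apply/forallP => t; apply/forallP => i; have [-> ->] := h1 t i (ltn_ord t).
Qed.

Definition pattern n L (la : nat -> nat) (h : nat -> nat -> nat) : bool :=
  chain n L la h && [forall i : 'I_L, h 0 i == 0].

Lemma patternP n L la h : (forall t i, L <= i -> h t i = 0) ->
  (forall i, L <= i -> la i = 0) ->
  reflect [/\ strips n h, forall i, h n i = la i & forall i, h 0 i = 0]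
          (pattern n L la h).
Proof.
move=> hz lz; apply: (iffP andP) => [[/chainP[] // h1 h2 h3 /forallP h4]|[h1 h2 h3]].
  split=> // i; have [Li|iL] := leqP L i; first exact: hz.
  exact/eqP/(h4 (Ordinal iL)).
split; last by apply/forallP => i; rewrite h3.
by apply/chainP => //; split => // i; rewrite !h3.
Qed.

Definition mono n (e : nat -> nat) : {mpoly int[n]} := (\prod_(t < n) 'X_t ^+ e t)%R.

Lemma eq_mono n e e' : (forall t, t < n -> e t = e' t) -> mono n e = mono n e'.
Proof. by move=> E; apply: eq_bigr => t _; rewrite E. Qed.

Lemma count_antitone (P : pred nat) N k : (forall j, P j.+1 -> P j) -> k < N ->
  (k < count P (iota 0 N)) = P k.
Proof.
move=> anti; have antiD j d : P (j + d) -> P j.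
  by elim: d => [|d IH]; rewrite ?addn0 // addnS => /anti.
move=> kN; rewrite -{1}[N](subnKC (ltnW kN)) iotaD count_cat add0n -(subnSK kN) /=.
case Pk: (P k).
  have : all P (iota 0 k).
    apply/allP => j; rewrite mem_iota => jk; apply: (@antiD _ (k - j)).
    by rewrite subnKC //; lia.
  by rewrite all_count size_iota => /eqP->; lia.
have : ~~ has P (iota k.+1 (N - k.+1)).
  apply/hasPn => j; rewrite mem_iota => jk; apply/negP => Pj.
  by move: Pk; rewrite (@antiD _ (j - k)) // subnKC //; lia.
rewrite has_count -eqn0Ngt => /eqP->.
by have := count_size P (iota 0 k); rewrite size_iota; lia.
Qed.

Lemma part_nonincr la i : is_part la -> nth 0 la i.+1 <= nth 0 la i.
Proof.
case/andP => sla _; have [h|h] := ltnP i.+1 (size la); last by rewrite nth_default.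
have geq_trans : transitive geq by move=> y x z xy yz; exact: leq_trans yz xy.
by have := sorted_ltn_nth geq_trans 0 sla i i.+1; rewrite !inE; apply; lia.
Qed.

Lemma part_mono la i j : is_part la -> i <= j -> nth 0 la j <= nth 0 la i.
Proof.
move=> pla /subnK <-; elim: (j - i) => [|d IH] //.
exact: leq_trans (part_nonincr _ pla) IH.
Qed.

(** * Semistandard tableaux and their cells *)

Definition cell_row la (c : cell la) : nat := (val c).1.
Definition cell_col la (c : cell la) : nat := (val c).2.

Lemma col_lt la (c : cell la) : cell_col c < nth 0 la (cell_row c).
Proof. exact: (valP c). Qed.

Lemma cell_inj la (c d : cell la) : cell_row c = cell_row d -> cell_col c = cell_col d -> c = d.
Proof.
move=> e1 e2; apply/val_inj; move: e1 e2; rewrite /cell_row /cell_col.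
by case: (val c) (val d) => [a b] [a' b'] /= /val_inj-> /val_inj->.
Qed.

Lemma cell_ex la i j : is_part la -> j < nth 0 la i ->
  exists c : cell la, cell_row c = i /\ cell_col c = j.
Proof.
move=> pla ji; have il : i < size la.
  by rewrite ltnNge; apply/negP => h; rewrite nth_default in ji.
have jh : j < head 0 la.
  by rewrite -nth0; apply: leq_trans ji (part_mono pla (leq0n i)).
by exists (Sub (Ordinal il, Ordinal jh) ji); rewrite /cell_row /cell_col SubK.
Qed.

Lemma card_row la i k : is_part la -> k <= nth 0 la i ->
  #|[pred c : cell la | (cell_row c == i) && (cell_col c < k)]| = k.
Proof.
move=> pla ki; rewrite -[RHS](card_ord k).
have ex (j : 'I_k) : {c : cell la | (cell_row c == i) && (cell_col c == j)}.
  apply: sigW; have [c [e1 e2]] := cell_ex pla (leq_trans (ltn_ord j) ki).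
  by exists c; rewrite e1 e2 !eqxx.
rewrite -(card_imset predT (f := fun j => sval (ex j))); last first.
  move=> j j' /(congr1 (@cell_col la)); have /andP[_ /eqP->] := svalP (ex j).
  by have /andP[_ /eqP->] := svalP (ex j') => /val_inj.
apply: eq_card => c; rewrite !inE; apply/idP/imsetP => [/andP[/eqP ri ck]|[j _ ->]].
  exists (Ordinal ck) => //; have /andP[/eqP e1 /eqP e2] := svalP (ex (Ordinal ck)).
  by apply: cell_inj; rewrite ?e1 ?e2 ?ri.
by have /andP[/eqP e1 /eqP e2] := svalP (ex j); rewrite e1 e2 eqxx ltn_ord.
Qed.

Lemma ssytP la n (T : {ffun cell la -> 'I_n}) :
  reflect ((forall c d, cell_row c = cell_row d -> cell_col c < cell_col d -> T c <= T d) /\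
           (forall c d, cell_col c = cell_col d -> cell_row c < cell_row d -> T c < T d))
          (is_ssyt T).
Proof.
apply: (iffP forallP) => [H|[H1 H2] c].
  split=> c d e lt; have /forallP/(_ d)/andP[/implyP h1 /implyP h2] := H c.
    by apply: h1; rewrite lt andbT; apply/eqP/val_inj.
  by apply: h2; rewrite lt andbT; apply/eqP/val_inj.
apply/forallP => d; apply/andP; split; apply/implyP => /andP[/eqP e lt].
  by apply: H1 => //; rewrite /cell_row e.
by apply: H2 => //; rewrite /cell_col e.
Qed.

Definition shape_upto la n (T : {ffun cell la -> 'I_n}) (t i : nat) : nat :=
  #|[pred c | (cell_row c == i) && (T c < t)]|.

Lemma shape_upto_le la n (T : {ffun cell la -> 'I_n}) t i : is_part la ->
  shape_upto T t i <= nth 0 la i.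
Proof.
move=> pla; rewrite -(card_row pla (leqnn (nth 0 la i))); apply: subset_leq_card.
apply/subsetP => c; rewrite !inE => /andP[/eqP ri _].
by rewrite ri eqxx -ri col_lt.
Qed.

Lemma ltn_shape_upto la n (T : {ffun cell la -> 'I_n}) t c : is_part la ->
  is_ssyt T -> (cell_col c < shape_upto T t (cell_row c)) = (T c < t).
Proof.
move=> pla /ssytP[H _]; have [lt|ge] := ltnP (T c) t.
  rewrite -{1}[(cell_col c).+1](card_row pla (col_lt c)); apply: subset_leq_card.
  apply/subsetP => d; rewrite !inE => /andP[/eqP rd cd]; rewrite rd eqxx /=.
  apply: leq_ltn_trans lt; move: cd; rewrite ltnS leq_eqVlt => /orP[/eqP e|].
    by rewrite (cell_inj rd e).
  exact: H.
apply/negbTE; rewrite -leqNgt -[cell_col c](card_row pla (ltnW (col_lt c))).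
apply: subset_leq_card; apply/subsetP => d; rewrite !inE.
move=> /andP[/eqP rd td]; rewrite rd eqxx /= ltnNge leq_eqVlt; apply/negP.
case/orP => [/eqP e|lt].
  by move: ge; rewrite (cell_inj (esym rd) e) leqNgt td.
by have := H _ _ (esym rd) lt; lia.
Qed.

Lemma shape_uptoS la n (T : {ffun cell la -> 'I_n}) t i :
  shape_upto T t.+1 i =
    shape_upto T t i + #|[pred c | (cell_row c == i) && (T c == t :> nat)]|.
Proof.
rewrite /shape_upto -!sum1_card (bigID (fun c => T c < t)) /=; congr (_ + _).
  by apply: eq_bigl => c; rewrite !inE; lia.
by apply: eq_bigl => c; rewrite !inE; lia.
Qed.

Lemma tableau_mono la n L (T : {ffun cell la -> 'I_n}) : size la <= L ->
  (\prod_(c : cell la) 'X_(T c))%R = mono n (fun t => wt (shape_upto T) t L).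
Proof.
move=> sL; rewrite (partition_big T predT) //=; apply: eq_bigr => t _.
rewrite (eq_bigr (fun=> 'X_t : {mpoly int[n]})%R); last by move=> c /eqP->.
rewrite prodr_const; congr (_ ^+ _)%R.
rewrite /wt (eq_bigr (fun i : 'I_L => \sum_(c | (cell_row c == i) && (T c == t)) 1)).
  rewrite -sum1_card (partition_big (fun c => widen_ord sL (val c).1) predT) //=.
  apply: eq_bigr => i _; apply: eq_bigl => c; rewrite andbC; congr (_ && _).
move=> i _; rewrite shape_uptoS addKn -sum1_card.
by apply: eq_bigl => c; rewrite !inE.
Qed.

(** The entry of [c] is the last [t] whose shape does not contain [c]; the predecessor is taken
    because [t = 0], with its empty shape, is counted too. *)
Definition filling la n (h : nat -> nat -> nat) : {ffun cell la -> 'I_n.+1} :=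
  [ffun c => inord (count (fun t => h t (cell_row c) <= cell_col c) (iota 0 n.+2)).-1].

Lemma filling_lt la n h (c : cell la) t : strips n.+1 h ->
  (forall i, h n.+1 i = nth 0 la i) -> (forall i, h 0 i = 0) -> t <= n.+1 ->
  (filling la n h c < t) = (cell_col c < h t (cell_row c)).
Proof.
move=> sh h1 h0 tn.
(* [h] need not be increasing beyond row [n.+1]. *)
pose P t := (h t (cell_row c) <= cell_col c) && (t <= n.+1).
have E : count (fun t => h t (cell_row c) <= cell_col c) (iota 0 n.+2) = count P (iota 0 n.+2).
  by apply: eq_in_count => x; rewrite mem_iota /P; lia.
have cP x : x < n.+2 -> (x < count P (iota 0 n.+2)) = P x.
  apply: count_antitone => j /andP[p1 p2]; have [_] := sh j (cell_row c) p2.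
  by rewrite /P; lia.
rewrite ffunE E; have := cP n.+1 (ltnSn _); have := cP 0 isT; have := cP t tn.
move: (count P _) => N; have := col_lt c; rewrite /P h0 h1 => H1 H2 H3 H4.
rewrite inordK; lia.
Qed.

Lemma filling_ssyt la n h : strips n.+1 h ->
  (forall i, h n.+1 i = nth 0 la i) -> (forall i, h 0 i = 0) ->
  is_ssyt (filling la n h).
Proof.
move=> sh h1 h0; apply/ssytP; split=> c d e lt.
  have := ltn_ord (filling la n h d); rewrite ltnS => tn.
  rewrite -ltnS filling_lt // e.
  by apply: ltn_trans lt _; rewrite -(@filling_lt la n).
have tn := ltn_ord (filling la n h d).
rewrite filling_lt //; last exact: ltnW.
have : filling la n h d < (filling la n h d).+1 by [].
rewrite filling_lt // e; set t := nat_of_ord _ in tn *.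
have mono_i x i j : x <= n.+1 -> i <= j -> h x j <= h x i.
  move=> xn /subnK <-; elim: (j - i) => [|k IH] //; apply: leq_trans IH.
  rewrite addSn; case: x xn => [|x] xn; first by rewrite !h0.
  by have [q1 _] := sh x (k + i) xn; have [_ q2] := sh x (k + i) xn; lia.
case: (cell_row d) lt => [|r] //; rewrite ltnS => lt cd.
have [q1 _] := sh t r tn.
by have := mono_i t _ _ (ltnW tn) lt; lia.
Qed.

(** A tableau corresponds to its chain of shapes [shape_upto], with inverse [filling]. *)
Lemma schur_pattern la n L K : is_part la -> size la <= L -> head 0 la <= K ->
  schur la n.+1 =
    (\sum_(g : array n.+1 L K | pattern n.+1 L (nth 0%N la) (ev g))
       mono n.+1 (fun t => wt (ev g) t L))%R.
Proof.
move=> pla sL hK.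
have lz i : L <= i -> nth 0 la i = 0 by move=> h; rewrite nth_default ?(leq_trans sL).
have leK (T : {ffun cell la -> 'I_n.+1}) t i : shape_upto T t i <= K.
  apply: leq_trans (shape_upto_le T t i pla) (leq_trans _ hK).
  by rewrite -nth0 part_mono.
have evE (T : {ffun cell la -> 'I_n.+1}) t i : t <= n.+1 ->
    ev (mk n.+1 L K (shape_upto T)) t i = shape_upto T t i.
  move=> tn; have [Li|iL] := leqP L i; last by rewrite ev_mk.
  rewrite ev_out //; have := shape_upto_le T t i pla; rewrite lz //; lia.
have toG (T : {ffun cell la -> 'I_n.+1}) : is_ssyt T ->
    pattern n.+1 L (nth 0 la) (ev (mk n.+1 L K (shape_upto T))).
  move=> sT; apply/patternP => //; first by move=> *; rewrite ev_out.
  split=> [t i tn|i|i]; rewrite !evE //; try lia.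
  - split; last by rewrite shape_uptoS leq_addr.
    rewrite leqNgt; apply/negP => lt.
    have [|c [rc cc]] := @cell_ex la i.+1 (shape_upto T t i) pla.
      exact: leq_trans lt (shape_upto_le _ _ _ pla).
    have [|d [rd cd]] := @cell_ex la i (shape_upto T t i) pla.
      rewrite -cc; apply: leq_trans (col_lt c) _; rewrite rc; exact: part_nonincr.
    have /ssytP[_ /(_ d c)] := sT; rewrite cc cd rc rd => /(_ erefl (ltnSn i)).
    have := ltn_shape_upto t.+1 c pla sT; have := ltn_shape_upto t d pla sT.
    rewrite rc cc rd cd; lia.
  - rewrite -(card_row pla (leqnn (nth 0 la i))); apply: eq_card => c.
    rewrite !inE ltn_ord andbT; case: eqP => //= <-; by rewrite col_lt.
  - by apply: eq_card0 => c; rewrite !inE andbF.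
have toGK (T : {ffun cell la -> 'I_n.+1}) : is_ssyt T ->
    filling la n (ev (mk n.+1 L K (shape_upto T))) = T.
  move=> sT; have /patternP[] // := toG _ sT; first by move=> *; rewrite ev_out.
  move=> h1 h2 h3; apply/ffunP => c; apply/val_inj.
  have E t : t <= n.+1 ->
      (filling la n (ev (mk n.+1 L K (shape_upto T))) c < t) = (T c < t).
    by move=> tn; rewrite filling_lt // evE // ltn_shape_upto.
  by have := E _ (ltn_ord (T c)); have := E _ (ltn_ord (filling la n
       (ev (mk n.+1 L K (shape_upto T))) c)); rewrite /=; lia.
rewrite /schur (reindex_onto (fun g : array n.+1 L K => filling la n (ev g))
  (fun T => mk n.+1 L K (shape_upto T))) /=; last by move=> T /toGK.
have fK (g : array n.+1 L K) : pattern n.+1 L (nth 0 la) (ev g) ->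
    mk n.+1 L K (shape_upto (filling la n (ev g))) = g.
  move=> /patternP[] // => [*|h1 h2 h3]; first by rewrite ev_out.
  apply: ev_inj => t i tn iL; rewrite evE //.
  have le_h : ev g t i <= nth 0 la i.
    by rewrite -h2; apply: strips_mono h1 tn (leqnn _).
  rewrite -(card_row pla le_h); apply: eq_card => c; rewrite !inE.
  by case: eqP => //= <-; rewrite filling_lt.
apply: eq_big => [g|g /andP[sg /eqP eg]].
  apply/andP/idP => [[sg /eqP eg]|pg]; first by rewrite -eg toG.
  split; last by rewrite fK.
  by move: pg => /patternP[] // => [*|h1 h2 h3]; [rewrite ev_out | apply: filling_ssyt].
rewrite (tableau_mono _ sL); apply: eq_mono => t tn; apply: eq_wt => j _.
by rewrite -{2 4}eg !evE //; lia.
Qed.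

(** * Alternants *)

Definition alt n (e : nat -> nat) : {mpoly int[n]} :=
  (\det (\matrix_(i < n, j < n) 'X_j ^+ e i))%R.

Lemma eq_alt n e e' : (forall i, i < n -> e i = e' i) -> alt n e = alt n e'.
Proof. by move=> E; congr (\det _)%R; apply/matrixP => i j; rewrite !mxE E. Qed.

Lemma alt_perm n (e e' : nat -> nat) (s : 'S_n) : (forall i : 'I_n, e' i = e (s i)) ->
  alt n e' = ((-1) ^+ s * alt n e)%R.
Proof.
move=> E; rewrite /alt -det_perm -det_mulmx; congr (\det _)%R.
by rewrite -row_permE; apply/matrixP => i j; rewrite !mxE E.
Qed.

Lemma alt_swap n e e' k : k.+1 < n -> e' k = e k.+1 -> e' k.+1 = e k ->
  (forall i, i != k -> i != k.+1 -> e' i = e i) -> alt n e' = (- alt n e)%R.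
Proof.
move=> kn e1 e2 e3; have kn' := ltnW kn.
rewrite (@alt_perm n e e' (tperm (Ordinal kn') (Ordinal kn))).
  by rewrite odd_tperm -val_eqE /= ltn_eqF // expr1 mulN1r.
move=> i; case: tpermP => [->|->|] //= /eqP h1 /eqP h2.
by rewrite e3.
Qed.

Lemma alt_neq0 n : alt n (fun i => n - i.+1) != 0%R.
Proof.
pose f (i : 'I_n) := rev_ord i.
have fI : injective f by exact: rev_ord_inj.
rewrite (@alt_perm n id _ (perm fI)); last by move=> i; rewrite permE.
rewrite mulf_neq0 ?signr_eq0 //.
have -> : alt n id = (\det (Vandermonde n (\row_(j < n) ('X_j : {mpoly int[n]}))))%R.
  by congr (\det _)%R; apply/matrixP => i j; rewrite !mxE.
rewrite det_Vandermonde; apply/prodf_neq0 => i _; apply/prodf_neq0 => j ij.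
rewrite !mxE subr_eq0; apply/eqP => /(congr1 (mcoeff U_(j)%MM)).
by rewrite !mcoeffXU eqxx; case: eqP => // e; move: ij; rewrite e ltnn.
Qed.

Lemma msymXU n (s : 'S_n) i : msym s ('X_i : {mpoly int[n]}) = 'X_(s i)%R.
Proof. by rewrite /msym mmapX mmap1U. Qed.

Lemma msym_mono n (s : 'S_n) e :
  msym s (mono n e) = (\prod_(i < n) 'X_(s i) ^+ e i)%R.
Proof.
by rewrite /mono rmorph_prod; apply: eq_bigr => i _; rewrite rmorphXn /= msymXU.
Qed.

(** In the Leibniz term of a permutation [s], the factor [p] may be replaced by [msym s p]; each of
    its monomials then adds its exponents to [e] row by row. *)
Lemma alt_mul_sym n (I : finType) (D : pred I) (f : I -> nat -> nat) e
    (p : {mpoly int[n]}) :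
  p = (\sum_(x | D x) mono n (f x))%R -> (forall s : 'S_n, msym s p = p) ->
  (alt n e * p = \sum_(x | D x) alt n (fun i => (e i + f x i)%N))%R.
Proof.
move=> ep sp; rewrite /alt /determinant exchange_big mulr_suml /=.
apply: eq_bigr => s _; rewrite -{1}(sp s) ep raddf_sum mulr_sumr.
apply: eq_bigr => x _; rewrite /= msym_mono -mulrA -big_split /=.
by congr (_ * _)%R; apply: eq_bigr => i _; rewrite !mxE exprD.
Qed.

Lemma sum_involution (R : nmodType) (I : finType) (D : pred I) (f : I -> I)
    (F : I -> R) : (forall x, D x -> D (f x) /\ f (f x) = x) ->
  (\sum_(x | D x) F x = \sum_(x | D x) F (f x))%R.
Proof.
move=> H; rewrite (reindex_onto f f) /=; last by move=> x /H[].
apply: eq_bigl => x; apply/andP/idP => [[/H[d _] /eqP e]|/H[d e]].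
  by rewrite -e.
by rewrite e eqxx.
Qed.

Lemma msym_all n (p : {mpoly int[n]}) :
  (forall i j : 'I_n, j = i.+1 :> nat -> msym (tperm i j) p = p) ->
  forall s : 'S_n, msym s p = p.
Proof.
move=> H.
have T d (i j : 'I_n) : j = i + d :> nat -> msym (tperm i j) p = p.
  elim: d i j => [|d IH] i j e.
    have -> : i = j by apply/val_inj; rewrite /= e addn0.
    by rewrite tperm1 msym1m.
  have mn : i + d < n by have := ltn_ord j; lia.
  pose m := Ordinal mn; have e' : j = m.+1 :> nat by rewrite e addnS.
  have [d0|d0] := posnP d; first by apply: H; rewrite e d0 addn1.
  have -> : tperm i j = (tperm i m ^ tperm m j)%g.
    rewrite tpermJ tpermL tpermD // -val_eqE /=; lia.
  by rewrite conjgE tpermV !msymMm (H m j e') (IH i m) // (H m j e').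
move=> s; have [ts -> _] := prod_tpermP s.
elim: ts => [|[i j] ts IH]; first by rewrite big_nil msym1m.
rewrite big_cons msymMm /=.
have -> // : msym (tperm i j) p = p.
have [ij|ji] := leqP i j; first by apply: (T (j - i)); lia.
by rewrite tpermC; apply: (T (i - j)); lia.
Qed.

(** * Flips of arrays and the symmetry of Schur polynomials *)

Lemma ev_patternP n L K la (g : array n L K) : (forall i, L <= i -> la i = 0) ->
  reflect [/\ strips n (ev g), forall i, ev g n i = la i & forall i, ev g 0 i = 0]
          (pattern n L la (ev g)).
Proof. by move=> lz; apply: patternP => // t i; apply: ev_out. Qed.

Lemma pattern_strips n L K la (g : array n L K) :
  (forall i, L <= i -> la i = 0) -> pattern n L la (ev g) -> strips n (ev g).
Proof. by move=> lz /(ev_patternP _ lz)[]. Qed.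

Definition aflip n L K (g : array n L K) (k i u : nat) : array n L K :=
  mk n L K (flip (ev g) k i u).

Lemma ev_aflip n L K (g : array n L K) k i u t j : strips n (ev g) ->
  k.+1 < n -> i < L -> flippable (ev g) k i u ->
  ev (aflip g k i u) t j = flip (ev g) k i u t j.
Proof.
move=> sg kn iL fl; have ez t' j' : L <= j' -> ev g t' j' = 0 by exact: ev_out.
have [Lj|jL] := leqP L j; first by rewrite ev_out // (flip_zero sg kn fl iL ez).
have [tn|nt] := leqP t n; last first.
  rewrite flip_neq; last lia.
  by rewrite /ev [insub t]insubF // ltnS leqNgt nt.
rewrite ev_mk //; have [->|ne] := eqVneq t k.+1; last first.
  by rewrite flip_neq // ev_le.
have [ji|ij] := ltnP j i; first by rewrite flip_lt // ev_le.
have [_] := flip_bounds sg kn fl ij; case: fl => _ h2 _.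
have := ev_le g k.+2 i; have := ev_le g k.+2 j.
by case: eqP => _; rewrite ?/upper; lia.
Qed.

Lemma aflipK n L K (g : array n L K) k i u : strips n (ev g) ->
  k.+1 < n -> i < L -> flippable (ev g) k i u ->
  aflip (aflip g k i u) k i u = g.
Proof.
move=> sg kn iL fl; apply: ev_inj => t j tn jL.
have E t' j' := ev_aflip t' j' sg kn iL fl.
rewrite ev_mk //; first by rewrite -[RHS](flipK t j sg kn fl) /flip /upper /lower !E.
have := flipK t j sg kn fl; rewrite {1}/flip /upper /lower -!E => Ef.
by rewrite /flip /upper /lower Ef ev_le.
Qed.

Lemma aflip_pattern n L K la (g : array n L K) k i u :
  (forall i, L <= i -> la i = 0) -> pattern n L la (ev g) ->
  k.+1 < n -> i < L -> flippable (ev g) k i u ->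
  pattern n L la (ev (aflip g k i u)).
Proof.
move=> lz pg kn iL fl; have sg := pattern_strips lz pg.
have /(ev_patternP _ lz)[_ h1 h2] := pg; apply/(ev_patternP _ lz).
split=> [t j tn|j|j]; rewrite !ev_aflip //.
- by have := flip_strips sg kn fl; apply.
- by rewrite flip_neq //; lia.
- by rewrite flip_neq.
Qed.

(** The Bender-Knuth involution exchanges the exponents of two neighbouring variables, and adjacent
    transpositions generate the symmetric group. *)
Lemma schur_sym la n (s : 'S_n.+1) : is_part la -> msym s (schur la n.+1) = schur la n.+1.
Proof.
move=> pla; pose L := (size la).+1; pose K := head 0 la.
have lz i : L <= i -> nth 0 la i = 0 by move=> h; rewrite nth_default // ltnW.
have sE := @schur_pattern la n L K pla (leqnSn _) (leqnn _).
apply: msym_all => i j ij {s}; rewrite sE raddf_sum.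
have kn : i.+1 < n.+1 by rewrite -ij ltn_ord.
have fl (g : array n.+1 L K) : pattern n.+1 L (nth 0 la) (ev g) ->
    flippable (ev g) i 0 (ev g i.+2 0).
  by move=> pg; split => //; have [] := pattern_strips lz pg 0 kn.
rewrite (@sum_involution _ _ _ (fun g => aflip g i 0 (ev g i.+2 0))) /=; last first.
  move=> g pg; split; first exact: aflip_pattern (fl _ pg).
  have sg := pattern_strips lz pg.
  rewrite [ev (aflip _ _ _ _) i.+2 0]ev_aflip ?flip_neq //; [|lia|exact: fl].
  by rewrite aflipK //; apply: fl.
apply: eq_bigr => g pg; have sg := pattern_strips lz pg.
rewrite msym_mono /mono (reindex_inj (@perm_inj _ (tperm i j))) /=.
apply: eq_bigr => t _; rewrite tpermK; congr (_ ^+ _)%R.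
have ez t' j' : L <= j' -> ev g t' j' = 0 by exact: ev_out.
have [w1 w2] := flip0_wt sg kn (ltn0Sn _) ez.
have E t' : wt (ev (aflip g i 0 (ev g i.+2 0))) t' L =
    wt (flip (ev g) i 0 (ev g i.+2 0)) t' L.
  by apply: eq_wt => j' _; rewrite !ev_aflip //; apply: fl.
rewrite E; case: tpermP => [->|->|/eqP h1 /eqP h2].
- by rewrite ij w2.
- by rewrite w1 ij.
- by rewrite flip_wt_neq //; rewrite -?ij.
Qed.

(** * The sign-reversing involution on bad patterns *)

Lemma find_iota (a : pred nat) M c : c < M -> a c ->
  (forall c', c' < c -> ~~ a c') -> find a (iota 0 M) = c.
Proof.
move=> cM ac H; have h : has a (iota 0 M).
  by apply/hasP; exists c; rewrite ?mem_iota.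
have := nth_find 0 h; have := @before_find _ 0 a (iota 0 M) c.
rewrite !nth_iota ?add0n //; last by rewrite -{2}(size_iota 0 M) -has_find.
have [lt|gt|//] := ltngtP (find a (iota 0 M)) c.
  by move=> _ h1; have := H _ lt; rewrite h1.
by move=> /(_ isT); rewrite ac.
Qed.

(* The code [c] stands for row [c %/ n] and letter [n.-1 - c %% n]: the involution
   must start from the largest bad letter of the first bad row, since flipping
   the letters [k] and [k.+1] disturbs the smaller letters in the same row. *)
Definition bad_code (D : pred nat) (e : nat -> nat) n (h : nat -> nat -> nat)
    (c : nat) : bool :=
  [&& (n.-1 - c %% n).+1 < n, D (n.-1 - c %% n) & bad e h (n.-1 - c %% n) (c %/ n)].

Definition has_bad D e n L h : bool := has (bad_code D e n h) (iota 0 (L * n)).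

Lemma has_badPn (D : pred nat) e n L h : 0 < n -> reflect
  (forall k i, k.+1 < n -> D k -> i < L -> ~~ bad e h k i)
  (~~ has_bad D e n L h).
Proof.
move=> n0; apply: (iffP hasPn) => [H k i kn Dk iL|H c].
  have r : n.-1 - k < n by lia.
  have /H : i * n + (n.-1 - k) \in iota 0 (L * n).
    rewrite mem_iota /= add0n; apply: leq_trans (_ : i * n + n <= _).
      by rewrite ltn_add2l.
    by rewrite addnC -mulSn leq_mul2r iL orbT.
  rewrite /bad_code modnMDl modn_small // divnMDl // divn_small // addn0.
  have -> : n.-1 - (n.-1 - k) = k by lia.
  by rewrite kn Dk.
rewrite mem_iota /= add0n => cL; apply/negP => /and3P[h1 h2].
by apply/negP/H => //; rewrite ltn_divLR.
Qed.

Definition first_bad D e n L h : nat := find (bad_code D e n h) (iota 0 (L * n)).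

Definition first_letter D e n L h : nat := n.-1 - first_bad D e n L h %% n.

Definition first_row D e n L h : nat := first_bad D e n L h %/ n.

(** Stembridge's involution: a flip at the first bad place in the order of codes, with everything
    read before the balance frozen. *)
Definition cancel_bad n L K D e (g : array n L K) : array n L K :=
  let k := first_letter D e n L (ev g) in
  let i := first_row D e n L (ev g) in
  aflip g k i (cut e (ev g) k i).

Lemma first_badP (D : pred nat) e n L h : 0 < n -> has_bad D e n L h ->
  let k := first_letter D e n L h in let i := first_row D e n L h in
  [/\ k.+1 < n, D k, i < L, bad e h k i & 0 < i -> ~~ bad e h k i.-1].
Proof.
move=> n0 hb k i; have := nth_find 0 hb; rewrite -/(first_bad D e n L h).
have cM : first_bad D e n L h < L * n.
  by move: hb; rewrite /has_bad has_find size_iota.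
rewrite nth_iota // add0n => /and3P[]; rewrite -/k -/i => h1 h2 h3.
have iL : i < L by rewrite ltn_divLR.
split=> // i0; have r : n.-1 - k < n by lia.
have lt : i.-1 * n + (n.-1 - k) < first_bad D e n L h.
  have E : i * n = i.-1 * n + n by rewrite -{1}(prednK i0) mulSn addnC.
  have := divn_eq (first_bad D e n L h) n.
  rewrite -[_ %/ n]/i; lia.
have := before_find 0 lt; rewrite nth_iota; last exact: ltn_trans cM.
rewrite add0n /bad_code modnMDl modn_small // divnMDl // divn_small // addn0.
have kn : k <= n.-1 by rewrite -ltnS prednK // ltnW.
by rewrite subKn // h1 h2 => /negbT.
Qed.

(** Places of smaller code keep their status by [bad_flip_prev] and the chosen place stays bad by
    [bad_flip], so a second application selects the same place. *)
Lemma first_bad_flip (D : pred nat) e n L h : 0 < n -> strips n h -> has_bad D e n L h ->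
  (forall k, k.+1 < n -> D k -> e k.+1 < e k) ->
  let k := first_letter D e n L h in let i := first_row D e n L h in
  has_bad D e n L (flip h k i (cut e h k i)) /\
  first_bad D e n L (flip h k i (cut e h k i)) = first_bad D e n L h.
Proof.
move=> n0 sh hb De k i; have [h1 h2 h3 h4 h5] := first_badP n0 hb.
rewrite -/k -/i in h1 h2 h3 h4 h5.
have fl := cut_flippable sh h1 (De _ h1 h2) h4 h5.
have cM : first_bad D e n L h < L * n.
  by move: hb; rewrite /has_bad has_find size_iota.
have E : first_bad D e n L h %% n = n.-1 - k.
  by rewrite /k /first_letter; have := ltn_pmod (first_bad D e n L h) n0; lia.
have bc : bad_code D e n (flip h k i (cut e h k i)) (first_bad D e n L h).
  by rewrite /bad_code -/k -/i h1 h2 (bad_flip sh h1 h4 fl).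
split; first by apply/hasP; exists (first_bad D e n L h); rewrite ?mem_iota.
apply: find_iota => // c lt; have := before_find 0 lt.
rewrite nth_iota; last exact: ltn_trans cM.
rewrite add0n => /negbT; rewrite /bad_code; case: (ltnP _ n) => //= kc.
case: (D _) => //=; rewrite bad_flip_prev //.
have le : c %/ n <= i by rewrite leq_div2r // ltnW.
have [e1|//] := eqVneq (c %/ n) i; last by lia.
have := divn_eq c n; have := divn_eq (first_bad D e n L h) n.
by rewrite E e1 -[_ %/ n]/i; have := ltn_pmod c n0; move: lt; lia.
Qed.

Lemma cancel_badP (D : pred nat) e n L K la (g : array n L K) : 0 < n ->
    (forall i, L <= i -> la i = 0) -> 
    (forall k, k.+1 < n -> D k -> e k.+1 < e k) ->
    pattern n L la (ev g) -> has_bad D e n L (ev g) ->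
  [/\ pattern n L la (ev (cancel_bad D e g)), has_bad D e n L (ev (cancel_bad D e g)),
      cancel_bad D e (cancel_bad D e g) = g &
      alt n (fun t => e t + wt (ev (cancel_bad D e g)) t L) =
        (- alt n (fun t => e t + wt (ev g) t L)%N)%R].
Proof.
move=> n0 lz De pg hb; have sg := pattern_strips lz pg.
have [h1 h2 h3 h4 h5] := first_badP n0 hb.
have [f1 f2] := first_bad_flip n0 sg hb De.
have fl := cut_flippable sg h1 (De _ h1 h2) h4 h5.
set k := first_letter D e n L (ev g) in h1 h2 h4 h5 f1 f2 fl.
set i := first_row D e n L (ev g) in h3 h4 h5 f1 f2 fl.
have cE : cancel_bad D e g = aflip g k i (cut e (ev g) k i) by [].
have E t j : ev (cancel_bad D e g) t j = flip (ev g) k i (cut e (ev g) k i) t j.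
  by rewrite cE ev_aflip.
have wE t l : wt (ev (cancel_bad D e g)) t l =
    wt (flip (ev g) k i (cut e (ev g) k i)) t l.
  by apply: eq_wt => ? _; rewrite !E.
have bE t j : bad e (ev (cancel_bad D e g)) t j =
    bad e (flip (ev g) k i (cut e (ev g) k i)) t j.
  by rewrite /bad !wE.
have bcE : bad_code D e n (ev (cancel_bad D e g)) =1
    bad_code D e n (flip (ev g) k i (cut e (ev g) k i)).
  by move=> c; rewrite /bad_code bE.
have fE : first_bad D e n L (ev (cancel_bad D e g)) = first_bad D e n L (ev g).
  by rewrite -f2; apply: eq_find.
split.
- by rewrite cE; apply: aflip_pattern.
- by rewrite /has_bad (eq_has bcE).
- rewrite {1}/cancel_bad /first_letter /first_row fE -/(first_letter D e n L (ev g)).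
  rewrite -/(first_row D e n L (ev g)) -/k -/i.
  have -> : cut e (ev (cancel_bad D e g)) k i = cut e (ev g) k i.
    rewrite -[RHS](cut_flip e (ev g) k i (cut e (ev g) k i)).
    by rewrite [LHS]/cut !wE E.
  by rewrite cE aflipK.
- have ez t' j' : L <= j' -> ev g t' j' = 0 by exact: ev_out.
  have [w1 w2] := cut_wt sg h1 h3 ez h4 fl.
  apply: (@alt_swap _ _ _ k) => //; rewrite ?wE //.
  by move=> t t1 t2; rewrite wE flip_wt_neq.
Qed.

(** The patterns with a bad place cancel under [cancel_bad]. Letters outside [D] are exempt from the
    condition, and [e] has to drop only at the letters in [D]. *)
Lemma alt_mul_schur la n L K (D : pred nat) e : is_part la -> size la <= L -> head 0 la <= K ->
    (forall k, k.+1 < n.+1 -> D k -> e k.+1 < e k) ->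
  (alt n.+1 e * schur la n.+1 =
   \sum_(g : array n.+1 L K |
        pattern n.+1 L (nth 0%N la) (ev g) && ~~ has_bad D e n.+1 L (ev g))
      alt n.+1 (fun t => (e t + wt (ev g) t L)%N))%R.
Proof.
move=> pla sL hK De.
have lz i : L <= i -> nth 0 la i = 0 by move=> h; rewrite nth_default ?(leq_trans sL).
rewrite (alt_mul_sym e (schur_pattern n pla sL hK) (fun s => schur_sym s pla)).
rewrite (bigID (fun g => has_bad D e n.+1 L (ev g))) /= [X in (X + _)%R](_ : _ = 0%R).
  by rewrite add0r.
set S := (\sum_(_ | _) _)%R; have SN : S = (- S)%R.
  rewrite {1}/S (@sum_involution _ _ _ (cancel_bad D e)) /=; last first.
    by move=> g /andP[pg hb]; have [-> ->] := cancel_badP (ltn0Sn n) lz De pg hb.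
  rewrite /S -sumrN; apply: eq_bigr => g /andP[pg hb].
  by have [_ _ _ ->] := cancel_badP (ltn0Sn n) lz De pg hb.
(* The coefficients are integers, so [S = - S] forces them to vanish. *)
apply/mpolyP => m; move/(congr1 (mcoeff m)): SN; rewrite mcoeffN mcoeff0; lia.
Qed.

(** * The injection on lattice chains *)

(** Row [t] of a skew tableau has [B t] empty columns, then the row indices of the boxes added at
    step [t]; the inequality makes its columns strict. *)
Definition lattice (m : nat) (B : nat -> nat) (u : nat -> nat -> nat) : Prop :=
  forall t i, t.+1 < m -> B t.+1 + wt u t.+1 i.+1 <= B t + wt u t i.

(** The first step after [q] that uses row 0, or [q] if there is none. Steps and rows count from 0;
    with [q + s.+1 = m], row [q] of [B] is the one that loses a box. *)
Definition pivot (u : nat -> nat -> nat) (q s : nat) : nat :=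
  if has (fun t => u t 0 < u t.+1 0) (iota q.+1 s)
  then q.+1 + find (fun t => u t 0 < u t.+1 0) (iota q.+1 s) else q.

(** A box of row 0 moves from step [p] to step [q], and row 1 gains a box at step [p]; for [p = q]
    only row 1 changes. *)
Definition push (q p : nat) (u : nat -> nat -> nat) (t i : nat) : nat :=
  u t i + [&& q < t, t <= p & i == 0] + ((p < t) && (i == 1)).

Lemma strips_diag m u t i d : strips m u -> d + t <= m ->
  u (d + t) (d + i) <= u t i.
Proof.
move=> su; elim: d => [|d IH] // dm.
by have := IH (ltnW dm); have [+ _] := su (d + t) (d + i) dm; rewrite !addSn; lia.
Qed.

Lemma pivotP m u q s : strips m u -> q + s.+1 = m ->
  (pivot u q s = q /\ forall t, q < t -> t < m -> u t.+1 0 = u t 0) \/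
  [/\ q < pivot u q s, pivot u q s < m,
      u (pivot u q s) 0 < u (pivot u q s).+1 0 &
      forall t, q < t -> t < pivot u q s -> u t.+1 0 = u t 0].
Proof.
move=> su em; rewrite /pivot; case: ifPn => [hs|nh]; [right | left].
  have fs := hs; rewrite has_find size_iota in fs.
  have nf := nth_find 0 hs; rewrite nth_iota // in nf.
  split; try lia.
  move=> t qt tf; have tm : t < m by lia.
  have := @before_find _ 0 _ (iota q.+1 s) (t - q.+1).
  rewrite nth_iota; last lia.
  have -> : q.+1 + (t - q.+1) = t by lia.
  have [_ h1] := su t 0 tm.
  move=> h2; have /h2/negbT : t - q.+1 < find (fun t => u t 0 < u t.+1 0) (iota q.+1 s).
    by lia.
  by rewrite -leqNgt; lia.
split=> // t qt tm; have [_ h1] := su t 0 tm.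
have /hasPn/(_ t) := nh; rewrite mem_iota; lia.
Qed.

(** As the two parts of [B] agree, the lattice condition at [i = 0] leaves no room for a box of row
    0 at step [q]. *)
Lemma lattice_col0 m u q B : strips m u -> lattice m B u ->
  0 < q -> q < m -> B q = B q.-1 -> u q.+1 0 = u q 0.
Proof.
move=> su gu q0 qm eB; have := gu q.-1 0; rewrite prednK // => /(_ qm).
rewrite wtS !wt0; have [_] := su q 0 qm; lia.
Qed.

(** Going back along the diagonal from row [s] of the last shape, of length [s], one meets row 1 of
    shape [q.+2], which is therefore already complete. *)
Lemma strips_col1 m u q s t : strips m u -> 0 < s -> q + s.+1 = m ->
  u m 1 = s -> u m s = s -> q.+1 < t -> t <= m -> u t 1 = s.
Proof.
move=> su s0 em e1 e2 qt tm.
have := @strips_diag m u q.+2 1 s.-1 su.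
have -> : s.-1 + q.+2 = m by lia.
have -> : s.-1 + 1 = s by lia.
have := strips_mono 1 su qt tm; have := strips_mono 1 su tm (leqnn m).
lia.
Qed.

Lemma push_rsum q p u t i :
  rsum (push q p u) t i =
  rsum u t i + [&& q < t, t <= p & 0 < i] + ((p < t) && (1 < i)).
Proof. by elim: i => [|i IH]; rewrite ?rsum0 ?rsumS ?IH /push; lia. Qed.

Lemma push_injection m q s b u (B B' : nat -> nat) :
    strips m u -> lattice m B u -> 0 < s -> s.+2 <= b -> 0 < q ->
    q + s.+1 = m -> u m 0 = b -> u m 1 = s -> u m s = s -> 0 < u m s.+1 ->
    B q = B q.-1 -> B q.+1 + s <= B q -> (forall t, B' t + (t == q) = B t) ->
  [/\ strips m (push q (pivot u q s) u),
      lattice m B' (push q (pivot u q s) u),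
      forall t L, t < m -> 1 < L ->
        B' t + wt (push q (pivot u q s) u) t L = B t + wt u t L,
      forall i, push q (pivot u q s) u 0 i = u 0 i &
      forall i, push q (pivot u q s) u m i = u m i + (i == 1)].
Proof.
move=> su gu s0 sb q0 em um0 um1 ums umS eB1 eB2 eB'.
have qm : q < m by lia.
have c0 := lattice_col0 su gu q0 qm eB1.
have c1 t := @strips_col1 m u q s t su s0 em um1 ums.
have pP := pivotP su em; set p := pivot u q s in pP *.
have qp : q <= p by case: pP => [[->]|[]] //; lia.
have pm : p < m by case: pP => [[->]|[]].
(* The nonempty row [s.+1] of the last shape forces, along a diagonal, a box in row 1 of shape
   [q.+1]. If the pivot is [q], step [q.+1] then adds fewer than [s] boxes to row 1, which offsets
   the box lost by row [q] of [B]. *)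
have a1 : 0 < u q.+1 1.
  have := @strips_diag m u q.+1 1 s su.
  have -> : s + q.+1 = m by lia.
  rewrite addn1; move=> /(_ (leqnn m)); lia.
have su' : strips m (push q p u).
  move=> t i tm; have [h1 h2] := su t i tm; rewrite /push.
  have [tq|qt] := ltnP t q; first lia.
  case: pP => [[ep nt]|[lt_qp lt_pm jp bp]].
    have [i0|i0] := eqVneq i 0; last lia.
    (* Row 0 does not grow from step [q] on, hence has its final length [b], while row 1 has at most
       [s < b] boxes. *)
    subst i; suff : u t.+1 1 < u t 0 by lia.
    have -> : u t 0 = b.
      have E d : d <= s -> u (q.+1 + d) 0 = u q.+1 0.
        elim: d => [|d IH] ds; first by rewrite addn0.
        by rewrite addnS nt ?IH //; lia.
      have Em : u q.+1 0 = b by rewrite -um0 -(E s) // addSnnS em.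
      have [<-|ntq] := eqVneq q t; first by rewrite -c0.
      have := E (t - q.+1); rewrite subnKC; last lia.
      by rewrite Em; apply; lia.
    by have := strips_mono 1 su tm (leqnn m); rewrite um1; lia.
  have [tp|pt] := ltnP t p; first lia.
  have [etp|ntp] := eqVneq t p; first by subst t; case: i h1 h2 => [|i] h1 h2; lia.
  have [i0|i0] := eqVneq i 0; last lia.
  (* Row 1 has length [s], and the pivot step has lengthened row 0 beyond [u p 0 >= s], so one more
     box fits below. *)
  subst i; rewrite c1; try lia.
  have := @strips_mono m u p.+1 t 0 su; have := @strips_mono m u p p.+1 0 su.
  have [+ _] := su p 0 lt_pm; rewrite c1; lia.
have W t i (tm : t < m) : wt (push q p u) t i + ((t == p) && (0 < i)) =
    wt u t i + ((t == q) && (0 < i)) + ((t == p) && (1 < i)).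
  have := wt_rsum i su' tm; have := wt_rsum i su tm; rewrite !push_rsum.
  lia.
split=> //.
- move=> t i tm; have := W t.+1 i.+1 tm; have := W t i (ltnW tm).
  have := gu t i tm; have := gu t 0 tm; have := eB' t; have := eB' t.+1.
  have w2 : wt u t.+1 2 = wt u t.+1 1 + (u t.+2 1 - u t.+1 1) by rewrite wtS.
  have w1 x : wt u x 1 = u x.+1 0 - u x 0 by rewrite wtS wt0.
  have z x : wt u x 0 = 0 by exact: wt0.
  have [etq|ntq] := eqVneq t q.
    subst t; have [hp|hp] := eqVneq q p.
      case: pP => [[_ nt]|[]]; last lia.
      have := nt q.+1 (ltnSn q) tm; have := c1 q.+2 (ltnSn _) tm.
      case: i => [|[|i]]; rewrite ?w1 ?w2 ?w1 ?z; lia.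
    case: pP => [[]|[lt_qp lt_pm jp bp]]; first lia.
    have bq : q.+1 < p -> u q.+2 0 = u q.+1 0 by apply: bp.
    case: i => [|i]; rewrite ?w1 ?z; lia.
  have [etp|ntp] := eqVneq t p.
    subst t; case: pP => [[]|[lt_qp lt_pm jp bp]]; first lia.
    have := c1 p.+1; have := c1 p.+2.
    case: i => [|[|i]]; rewrite ?w2 ?w1 ?z; lia.
  lia.
- move=> t L tm L1; have := W t L tm; have := eB' t; lia.
- by move=> i; rewrite /push; lia.
- by move=> i; rewrite /push; lia.
Qed.

Lemma push_inj m q s u v (B : nat -> nat) :
    strips m u -> strips m v -> lattice m B u -> lattice m B v ->
    0 < s -> 0 < q -> q + s.+1 = m -> u m 1 = s -> u m s = s ->
    v m 1 = s -> v m s = s -> B q = B q.-1 ->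
    (forall t i, t <= m ->
       push q (pivot u q s) u t i = push q (pivot v q s) v t i) ->
  forall t i, t <= m -> u t i = v t i.
Proof.
move=> su sv gu gv s0 q0 em u1 us v1 vs eB e.
have qm : q < m by lia.
have qm1 := ltnW qm.
suff ep : pivot u q s = pivot v q s.
  by move=> t i tm; have := e t i tm; rewrite ep /push; lia.
have cu0 := lattice_col0 su gu q0 qm eB; have cv0 := lattice_col0 sv gv q0 qm eB.
have cu1 t := @strips_col1 m u q s t su s0 em u1 us.
have cv1 t := @strips_col1 m v q s t sv s0 em v1 vs.
have pu : q <= pivot u q s /\ pivot u q s < m.
  by case: (pivotP su em) => [[->]|[]] //; lia.
have pv : q <= pivot v q s /\ pivot v q s < m.
  by case: (pivotP sv em) => [[->]|[]] //; lia.
move: (pivot u q s) (pivot v q s) pu pv e => p p' pu pv e.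
(* If [p < p'], row 1 of shape [p'] has length [s.+1] in one image and [s] in the other, unless
   [p = q] and [p' = q.+1]; then row 0 grows at step [q] in only one image. The other case is
   symmetric. *)
have := e q 0 qm1; have := e q.+1 0 qm; rewrite /push.
have := e p' 1; have := e p 1; rewrite /push.
have := cu1 p; have := cv1 p; have := cu1 p'; have := cv1 p'; lia.
Qed.

(** * The Littlewood-Richardson rule *)

Lemma wt_const h L t i : (forall j, L <= j -> h t.+1 j = 0) -> L <= i ->
  wt h t i = wt h t L.
Proof.
move=> hz /subnK <-; elim: (i - L) => [|d IH] //.
by rewrite addSn wtS IH hz ?leq_addl // sub0n addn0.
Qed.

Lemma has_badP_all (D : pred nat) e n L h : 0 < n -> 0 < L ->
  (forall t j, L <= j -> h t j = 0) ->
  reflect (forall k i, k.+1 < n -> D k -> ~~ bad e h k i) (~~ has_bad D e n L h).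
Proof.
move=> n0 L0 hz; apply: (iffP (has_badPn D e L h n0)) => [H k i kn Dk|H k i kn Dk _].
  have [Li|iL] := leqP L i; last exact: H.
  have L1 : L.-1 < L by rewrite prednK.
  have := H _ _ kn Dk L1; rewrite /bad prednK // -!ltnNge.
  rewrite (@wt_const h L k.+1 i.+1) ?(@wt_const h L k i) //; try by move=> j; exact: hz.
    by move=> /leq_trans; apply; rewrite leq_add2l leq_wt // leq_pred.
  exact: leqW.
exact: H.
Qed.

(** The chain of the tableau whose row [i] is filled with the letter [i]. *)
Definition staircase (f : nat -> nat) (t i : nat) : nat := if i < t then f i else 0.

Lemma wt_staircase h f t l : (forall j, h t j = staircase f t j) ->
  (forall j, h t.+1 j = staircase f t.+1 j) -> wt h t l = if t < l then f t else 0.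
Proof.
move=> h1 h2; elim: l => [|l IH]; first by rewrite wt0.
rewrite wtS IH h1 h2 /staircase !ltnS.
by case: (ltngtP t l) => [?|?|->]; lia.
Qed.

(** The condition carries a zero count down the diagonal, so letter [x] does not occur before row
    [x]; interlacing from the empty shape keeps it out of later rows. *)
Lemma lattice_staircase h n d t i : strips n h -> (forall i, h 0 i = 0) -> d <= n ->
  (forall k j, k.+1 < d -> wt h k.+1 j.+1 <= wt h k j) -> t <= d ->
  h t i = staircase (h d) t i.
Proof.
move=> sh h0 dn lat td.
have z x j : x <= d -> x <= j -> h x j = 0.
  elim: x j => [|x IH] [|j] // xd xj.
  by have [] := sh x j (leq_trans xd dn); rewrite IH //; lia.
have w x : x < d -> wt h x x = 0.
  elim: x => [|x IH] xd; first by rewrite wt0.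
  by have := lat x x xd; rewrite IH ?(ltnW xd); lia.
have c x j : x < d -> j < x -> h x.+1 j = h x j.
  move=> xd jx; have [_] := sh x j (leq_trans xd dn).
  by have := leq_wt h x jx; rewrite wtS w //; lia.
rewrite /staircase; case: ltnP => [it|ti]; last exact: z.
have -> : d = (d - t) + t by lia.
have : d - t <= d - t by [].
elim: {1 3}(d - t) => [|x IH] xd //.
by rewrite IH ?(ltnW xd) // addSn c //; lia.
Qed.

(** The bialternant formula: for the staircase exponents only one pattern has no bad place, the
    [staircase] of [la]. *)
Lemma alt_schur la n : is_part la -> size la <= n.+1 ->
  (alt n.+1 (fun i => (n.+1 - i.+1)%N) * schur la n.+1 =
    alt n.+1 (fun i => (n.+1 - i.+1 + nth 0 la i)%N))%R.
Proof.
move=> pla sn; pose K := head 0 la.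
have lz i : n.+1 <= i -> nth 0 la i = 0 by move=> h; rewrite nth_default ?(leq_trans sn).
rewrite (@alt_mul_schur la n n.+1 K predT) //; last by move=> k kn _ /=; lia.
pose f := staircase (nth 0 la); pose g0 := mk n.+1 n.+1 K f.
have fK t i : f t i <= K.
  by rewrite /f /staircase /K; case: ifP => // _; rewrite -nth0 part_mono.
have E t i : t <= n.+1 -> ev g0 t i = f t i.
  move=> tn; have [Li|iL] := leqP n.+1 i; last by rewrite ev_mk.
  by rewrite ev_out // /f /staircase; case: ifP => //; rewrite lz.
have ez (g : array n.+1 n.+1 K) t j : n.+1 <= j -> ev g t j = 0 by exact: ev_out.
rewrite (big_pred1 g0) => [|g].
  by apply: eq_alt => i iN; rewrite (@wt_staircase _ (nth 0 la)) ?iN // => j; rewrite E // ltnW.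
apply/andP/eqP => [[/(ev_patternP _ lz)[h1 h2 h3]]|->].
  move=> /(has_badP_all _ _ (ltn0Sn n) (ltn0Sn n) (ez g)) nb.
  have S := lattice_staircase _ h1 h3 (leqnn _).
  apply: ev_inj => t i tn iL; rewrite E // S //.
    by rewrite /f /staircase h2.
  by move=> k j kn; have := nb k j kn isT; rewrite /bad -ltnNge; lia.
split.
  apply/(ev_patternP _ lz); split=> [t i tn|i|i]; rewrite !E //; try lia.
  - by rewrite /f /staircase; have := part_nonincr i pla; do !case: ifP => ?; lia.
  - by rewrite /f /staircase; case: ltnP => // /lz->.
apply/(has_badP_all _ _ (ltn0Sn n) (ltn0Sn n) (ez g0)) => k i kn _.
rewrite /bad -ltnNge !(@wt_staircase _ (nth 0 la)); try by move=> j; rewrite E //; lia.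
by rewrite ltnS; case: ifP => _; have := part_nonincr k pla; lia.
Qed.

(** * Shapes contributed by chains and the product rule *)

Definition part_of (f : nat -> nat) (N : nat) : seq nat :=
  [seq p <- mkseq f N | p != 0].

Lemma part_ofE f N : (forall i, f i.+1 <= f i) ->
  exists2 k, part_of f N = mkseq f k & k <= N /\
    forall i, i < N -> (i < k) = (f i != 0).
Proof.
move=> fd; pose P i := f i != 0; pose k := count P (iota 0 N).
have cP i : i < N -> (i < k) = P i.
  by apply: count_antitone => j; rewrite /P; have := fd j; lia.
have kN : k <= N by rewrite -[N in _ <= N](size_iota 0 N) count_size.
exists k; last by [].
rewrite /part_of /mkseq filter_map; congr map.
rewrite -(subnKC kN) iotaD filter_cat add0n.
rewrite (_ : [seq _ <- iota 0 k | _] = iota 0 k); last first.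
  by apply/all_filterP/allP => i; rewrite mem_iota => ik /=; rewrite -[_ != _]cP; lia.
rewrite (_ : [seq _ <- iota k _ | _] = [::]) ?cats0 //.
apply/eqP; rewrite -size_eq0 size_filter -leqn0 leqNgt -has_count; apply/hasPn => i.
by rewrite mem_iota => ik /=; rewrite -[_ != _]cP; lia.
Qed.

Lemma part_of_part f N : (forall i, f i.+1 <= f i) -> is_part (part_of f N).
Proof.
move=> fd; apply/andP; split; last by rewrite mem_filter eqxx.
have [k -> _] := part_ofE N fd; apply/(sortedP 0) => i; rewrite size_mkseq => ik.
by rewrite (nth_mkseq _ _ (ltnW ik)) (nth_mkseq _ _ ik); apply: fd.
Qed.

Lemma nth_part_of f N i : (forall i, f i.+1 <= f i) -> (forall i, N <= i -> f i = 0) ->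
  nth 0 (part_of f N) i = f i.
Proof.
move=> fd fz; have [k -> [kN kP]] := part_ofE N fd.
have [ik|ki] := ltnP i k; first by rewrite nth_mkseq.
rewrite nth_default ?size_mkseq //; have [/fz->//|iN] := leqP N i.
by have := kP i iN; lia.
Qed.

Lemma size_part_of f N : size (part_of f N) <= N.
Proof. by rewrite size_filter (leq_trans (count_size _ _)) ?size_mkseq. Qed.

Definition latticeb m L (B : nat -> nat) (u : nat -> nat -> nat) : bool :=
  [forall t : 'I_m, forall i : 'I_L,
     (t.+1 < m) ==> (B t.+1 + wt u t.+1 i.+1 <= B t + wt u t i)].

Lemma latticeP m L B u : 0 < L -> (forall t j, L <= j -> u t j = 0) ->
  reflect (lattice m B u) (latticeb m L B u).
Proof.
move=> L0 uz; apply: (iffP forallP) => [H t i tm|H t].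
  have G j : j < L -> B t.+1 + wt u t.+1 j.+1 <= B t + wt u t j.
    by move=> jL; have /forallP/(_ (Ordinal jL))/implyP := H (Ordinal (ltnW tm)); apply.
  have [Li|] := leqP L i; last exact: G.
  have L1 : L.-1 < L by rewrite prednK.
  have := G _ L1; rewrite prednK // (@wt_const u L t.+1 i.+1) ?(@wt_const u L t i) //;
    try by move=> j; exact: uz.
    by move=> /leq_trans; apply; rewrite leq_add2l leq_wt // leq_pred.
  exact: leqW.
by apply/forallP => i; apply/implyP; apply: H.
Qed.

Definition lr_part m L (B : nat -> nat) (u : nat -> nat -> nat) (i : nat) : nat :=
  if i < m then B i + wt u i L else u 0 (i - m).

Definition lr_shape m L B u : seq nat := part_of (lr_part m L B u) (m + L).

Definition lr_set m L K (A B : nat -> nat) : pred (array m L K) :=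
  fun u => chain m L A (ev u) && latticeb m L B (ev u).
Arguments lr_set : clear implicits.

Lemma ev_chainP n L K la (g : array n L K) : (forall i, L <= i -> la i = 0) ->
  reflect [/\ strips n (ev g), forall i, ev g n i = la i &
              forall i, ev g 0 i.+1 <= ev g 0 i] (chain n L la (ev g)).
Proof. by move=> lz; apply: chainP => // t i; apply: ev_out. Qed.

(** Among the first [m] parts this is the lattice condition; at the junction, [B m.-1] is at least
    [A 0], which bounds [u 0 0]. *)
Lemma lr_part_nonincr m L K A B (u : array m L K) i : 0 < L -> 0 < m ->
  (forall i, L <= i -> A i = 0) -> A 0 <= B m.-1 -> lr_set m L K A B u ->
  lr_part m L B (ev u) i.+1 <= lr_part m L B (ev u) i.
Proof.
move=> L0 m0 Az AB /andP[/(ev_chainP _ Az)[h1 h2 h3]].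
have uz t j : L <= j -> ev u t j = 0 by exact: ev_out.
move=> /(latticeP _ _ L0 uz) lu; rewrite /lr_part.
have [im|mi] := ltnP i.+1 m.
  rewrite (ltnW im); have := lu i L.-1 im; rewrite prednK //.
  by have := leq_wt (ev u) i (leq_pred L); lia.
have [im|mi'] := ltnP i m.
  have -> : i.+1 - m = 0 by lia.
  have e : m.-1 = i by lia.
  by have := strips_mono 0 h1 (leq0n m) (leqnn m); rewrite h2; move: AB; rewrite e; lia.
by rewrite subSn.
Qed.

Lemma lr_part_zero m L K B (u : array m L K) i : m + L <= i ->
  lr_part m L B (ev u) i = 0.
Proof. by move=> h; rewrite /lr_part ifF ?ev_out //; lia. Qed.

Definition extend d (u : nat -> nat -> nat) (t i : nat) : nat :=
  if t < d then staircase (u 0) t i else u (t - d) i.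

Lemma rotation m d : exists s : 'S_(m + d), forall i : 'I_(m + d),
  s i = (if i < d then i + m else i - d) :> nat.
Proof.
have lt (i : 'I_(m + d)) : (if i < d then i + m else i - d) < m + d.
  by have := ltn_ord i; case: ifP => ?; lia.
have inj : injective (fun i => Ordinal (lt i)).
  move=> i j /(congr1 val) /= e; apply/val_inj => /=.
  by have := ltn_ord i; have := ltn_ord j; move: e; do 2!case: ifP => ?; lia.
by exists (perm inj) => i; rewrite permE.
Qed.

(* In the proof the letters [t < d] of a pattern stand for the last [d] variables,
   where [B] has no parts. The lattice condition is not imposed between the two
   blocks of letters, where [nth 0 A 0 <= nth 0 B m.-1] replaces it. *)
Lemma schur_mul (A B : seq nat) m L K n : is_part A -> is_part B -> 0 < L -> 0 < m ->
    size A <= L -> head 0 A <= K -> size B <= m -> nth 0 A 0 <= nth 0 B m.-1 ->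
    m + L <= n.+1 ->
  (schur A n.+1 * schur B n.+1 =
   \sum_(u | lr_set m L K (nth 0%N A) (nth 0%N B) u)
     schur (lr_shape m L (nth 0%N B) (ev u)) n.+1)%R.
Proof.
move=> pA pB L0 m0 sA hK sB AB mLn; pose d := n.+1 - m.
have nE : n.+1 = m + d by rewrite /d; lia.
have Ld : L <= d by rewrite /d; lia.
have Az i : L <= i -> nth 0 A i = 0 by move=> h; rewrite nth_default ?(leq_trans sA).
have Bz i : m <= i -> nth 0 B i = 0 by move=> h; rewrite nth_default ?(leq_trans sB).
have sBn : size B <= n.+1 by lia.
apply: (mulfI (alt_neq0 n.+1)).
rewrite mulrCA (alt_schur pB sBn) [LHS]mulrC [RHS]mulr_sumr.
have [s sE] : exists s : 'S_n.+1, forall i : 'I_n.+1,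
    s i = (if i < d then i + m else i - d) :> nat.
  by rewrite nE; apply: rotation.
(* The exponents of the bialternant of [B] in rotated order: the last [d], where [B] is zero, come
   first. *)
pose e t := if t < d then d - t.+1 else nth 0 B (t - d) + (n - (t - d)).
have eE : alt n.+1 e =
    ((-1) ^+ s * alt n.+1 (fun i => (n.+1 - i.+1 + nth 0 B i)%N))%R.
  apply: alt_perm => i; rewrite /e sE; have := ltn_ord i.
  by case: ifP => id iN; [rewrite Bz | ]; lia.
have -> : alt n.+1 (fun i => (n.+1 - i.+1 + nth 0 B i)%N) = ((-1) ^+ s * alt n.+1 e)%R.
  by rewrite eE mulrA -signr_addb addbb mul1r.
(* The exponents rise from letter [d.-1] to letter [d], so this pair is exempted. *)
rewrite -mulrA (@alt_mul_schur A n L K (fun k => k.+1 != d)) //; last first.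
  move=> k kn kd; rewrite /e; have := part_nonincr (k - d) pB.
  case: (ltnP k.+1 d) => h1; case: (ltnP k d) => h2; try lia.
  by rewrite subSn //; lia.
have ez n' (g : array n' L K) t j : L <= j -> ev g t j = 0 by exact: ev_out.
pose ext (u : array m L K) := mk n.+1 L K (extend d (ev u)).
have extE u t i : t <= n.+1 -> ev (ext u) t i = extend d (ev u) t i.
  move=> tn; have [Li|iL] := leqP L i.
    rewrite [LHS]ez // /extend /staircase.
    by do 2?case: ifP => // _; rewrite ez.
  rewrite ev_mk // /extend /staircase; case: ifP => _; last exact: ev_le.
  by case: ifP => // _; apply: ev_le.
pose res (g : array n.+1 L K) := mk m L K (fun t i => ev g (t + d) i).
have resE (g : array n.+1 L K) t i : t <= m -> ev (res g) t i = ev g (t + d) i.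
  move=> tm; have [Li|iL] := leqP L i; first by rewrite !ev_out.
  by rewrite ev_mk // ev_le.
(* Before letter [d] the exponents drop by one at each letter, so [lattice_staircase] applies: the
   first [d] letters are determined by the shape [ev g d], and [res] loses no information. *)
have goodP (g : array n.+1 L K) : pattern n.+1 L (nth 0 A) (ev g) &&
    ~~ has_bad (fun k => k.+1 != d) e n.+1 L (ev g) ->
    forall t i, t <= d -> ev g t i = staircase (ev g d) t i.
  move=> /andP[/(ev_patternP _ Az)[h1 h2 h3]].
  move=> /(has_badP_all _ _ (ltn0Sn n) L0 (ez _ g)) nb t i.
  have dn : d <= n.+1 by lia.
  apply: (lattice_staircase i h1 h3 dn) => k j kd.
  have := nb k j (leq_trans kd dn); rewrite /bad /e kd (ltnW kd) -ltnNge; lia.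
have resK (g : array n.+1 L K) : pattern n.+1 L (nth 0 A) (ev g) &&
    ~~ has_bad (fun k => k.+1 != d) e n.+1 L (ev g) -> ext (res g) = g.
  move=> /goodP gg; apply: ev_inj => t i tn iL; rewrite extE // /extend.
  case: ltnP => td; last by rewrite resE ?subnK //; lia.
  by rewrite gg ?(ltnW td) // /staircase resE.
rewrite (reindex_onto ext res) /=; last by move=> g /resK.
have extK u : res (ext u) = u.
  apply: ev_inj => t i tm iL; rewrite resE // extE; last lia.
  by rewrite /extend ifF ?addnK //; lia.
have wt_hi u t l : t < m -> wt (ev (ext u)) (t + d) l = wt (ev u) t l.
  move=> tm; apply: eq_bigr => j _; rewrite !extE; try lia.
  by rewrite /extend !ifF; try lia; rewrite -addSn !addnK.
have ext_lo u t i : t <= d -> ev (ext u) t i = staircase (ev u 0) t i.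
  move=> td; rewrite extE; last lia.
  rewrite /extend; case: ltnP => // dt; have -> : t = d by lia.
  by rewrite subnn /staircase; case: ltnP => // di; rewrite ez //; lia.
have wt_lo u t l : t < d -> wt (ev (ext u)) t l = if t < l then ev u 0 t else 0.
  by move=> td; apply: wt_staircase => j; rewrite ext_lo // ltnW.
have PE u : pattern n.+1 L (nth 0 A) (ev (ext u)) &&
    ~~ has_bad (fun k => k.+1 != d) e n.+1 L (ev (ext u)) =
    lr_set m L K (nth 0 A) (nth 0 B) u.
  apply/andP/andP => [[p1 p2]|[]].
    have gg := goodP _ (introT andP (conj p1 p2)).
    move/(ev_patternP _ Az): p1 => [h1 h2 h3].
    move/(has_badP_all _ _ (ltn0Sn n) L0 (ez _ (ext u))): p2 => nb.
    have E t i : t <= m -> ev u t i = ev (ext u) (t + d) i.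
      by move=> tm; rewrite -{1}(extK u) resE.
    split.
      apply/(ev_chainP _ Az); split=> [t i tm|i|i].
      - by rewrite !E ?(ltnW tm) //; apply: (h1 (t + d)); lia.
      - by rewrite E // -nE h2.
      - rewrite !E // add0n; have := gg d.-1 i (leq_pred d).
        have d1 : d.-1 < n.+1 by lia.
        have [] := h1 d.-1 i d1; rewrite prednK; last lia.
        rewrite /staircase; case: ifP => ?; lia.
    apply/(latticeP _ _ L0 (ez _ u)) => t i tm.
    have t1 : (t + d).+1 < n.+1 by lia.
    have := nb (t + d) i t1; rewrite /bad /e !ifF; try lia.
    rewrite -addSn !addnK -ltnNge !wt_hi //; last lia.
    move=> /(_ _); have h : t.+1 + d != d by lia.
    by move=> /(_ h); lia.
  move=> /(ev_chainP _ Az)[h1 h2 h3] /(latticeP _ _ L0 (ez _ u)) lu; split.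
    apply/(ev_patternP _ Az); split=> [t i tn|i|i].
    - have [td|dt] := ltnP t d.
        rewrite !ext_lo ?(ltnW td) // /staircase; have := h3 i.
        by do !case: ifP => ?; lia.
      rewrite !extE ?(ltnW tn) // /extend !ifF; try lia.
      by rewrite subSn //; apply: h1; lia.
    - rewrite extE // /extend ifF; last lia.
      by rewrite nE addnK h2.
    - by rewrite ext_lo.
  apply/(has_badP_all _ _ (ltn0Sn n) L0 (ez _ (ext u))) => k i kn kd.
  rewrite /bad -ltnNge /e; have [kd1|dk] := ltnP k.+1 d.
    rewrite (ltnW kd1) !wt_lo ?(ltnW kd1) // ltnS; have := h3 k.
    by case: ifP => _; lia.
  have dk' : d <= k by lia.
  rewrite ifF; last lia.
  have km : (k - d).+1 < m by lia.
  have := lu (k - d) i km; have := wt_hi u (k - d) i (ltnW km).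
  have := wt_hi u (k - d).+1 i.+1 km; rewrite addSn subnK // subSn //.
  by move=> -> ->; lia.
rewrite [LHS]mulr_sumr; apply: eq_big => [u|u]; rewrite extK eqxx andbT PE //.
move=> lru; have nd i := lr_part_nonincr i L0 m0 Az AB lru.
have zr i := @lr_part_zero m L K (nth 0 B) u i.
have ps := part_of_part (m + L) nd.
rewrite alt_schur //; last by apply: leq_trans (size_part_of _ _) mLn.
rewrite (@alt_perm n.+1
  (fun i => (n.+1 - i.+1 + nth 0 (lr_shape m L (nth 0 B) (ev u)) i)%N) _ s).
  by rewrite mulrA -signr_addb addbb mul1r.
move=> i; rewrite sE nth_part_of // /lr_part /e; have iN := ltn_ord i.
case: (ltnP i d) => id.
  rewrite ifF ?addnK ?wt_lo //; last lia.
  by case: ltnP => Li; [|rewrite ez //]; lia.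
rewrite ifT; last lia.
have im : i - d < m by lia.
by have := wt_hi u (i - d) L im; rewrite subnK // => ->; lia.
Qed.

(** * Schur positivity *)

Definition restriction N n : N.-tuple {mpoly int[n]} :=
  [tuple oapp (fun j : 'I_n => 'X_j : {mpoly int[n]})%R 0%R (insub (i : nat)) | i < N].

(** Tableaux with an entry at least [n] are sent to zero; the others are the tableaux with entries
    in ['I_n]. *)
Lemma schur_restrict la n N : n <= N ->
  (schur la N \mPo restriction N n)%R = schur la n.
Proof.
move=> nN; rewrite /schur raddf_sum /=.
pose wd (T : {ffun cell la -> 'I_n}) : {ffun cell la -> 'I_N} :=
  [ffun c => widen_ord nN (T c)].
have wdI : injective wd.
  move=> T T' /ffunP e; apply/ffunP => c; have := e c; rewrite !ffunE.
  by move/(congr1 val) => /= /val_inj.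
have tE (T : {ffun cell la -> 'I_N}) :
    ((\prod_(c : cell la) 'X_(T c)) \mPo restriction N n =
    \prod_(c : cell la) oapp (fun j : 'I_n => 'X_j) 0 (insub (T c : nat)))%R.
  rewrite rmorph_prod; apply: eq_bigr => c _ /=.
  by rewrite comp_mpolyXU -tnth_nth tnth_mktuple.
rewrite (eq_bigr _ (fun T _ => tE T)).
rewrite (bigID (fun T => [exists T', wd T' == T])) /= [X in (_ + X)%R]big1 ?addr0.
  rewrite (reindex_omap wd (fun T => [pick T' | wd T' == T])) /=; last first.
    move=> T /andP[_ /existsP[T' /eqP e]]; case: pickP => [T1 /eqP <-|/(_ T')] //.
    by rewrite e eqxx.
  apply: eq_big => [T|T _].
    have -> : [exists T', wd T' == wd T] by apply/existsP; exists T.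
    case: pickP => [T1 /eqP /wdI ->|/(_ T)]; last by rewrite eqxx.
    by rewrite eqxx !andbT /is_ssyt; do 2!apply: eq_forallb => ?; rewrite !ffunE.
  by apply: eq_bigr => c _; rewrite ffunE /= valK.
move=> T /andP[_ /existsPn nex].
have [/forallP H|] := boolP [forall c, T c < n].
  have /negP[] := nex [ffun c => Ordinal (H c)].
  by apply/eqP/ffunP => c; rewrite !ffunE; apply/val_inj.
rewrite negb_forall => /existsP[c nc].
by rewrite (bigD1 c) //= insubN //= mul0r.
Qed.

(** The coefficient of a partition is the number of indices with that shape, the same for every
    [n]. *)
Lemma schur_positive_sum (I : finType) (D : pred I) (sh : I -> seq nat) (f : symfun) :
  (forall x, D x -> is_part (sh x)) ->
  (forall n, f n = \sum_(x | D x) schur (sh x) n)%R -> schur_positive f.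
Proof.
move=> psh fE; pose s := undup [seq sh x | x <- enum D].
exists s, (fun la => (#|[pred x | D x && (sh x == la)]|)%:Z)%R; split; last by [].
split; first exact: undup_uniq.
  by apply/allP => la; rewrite mem_undup => /mapP[x]; rewrite mem_enum => /psh ? ->.
move=> n; rewrite fE.
transitivity (\sum_(la <- s) \sum_(x | D x) if sh x == la then schur la n else 0)%R.
  rewrite exchange_big /=; apply: eq_bigr => x Dx.
  have xs : sh x \in s by rewrite mem_undup map_f // mem_enum.
  rewrite (bigD1_seq (sh x)) ?undup_uniq //= eqxx big1 ?addr0 // => la.
  by rewrite eq_sym => /negPf->.
apply: eq_bigr => la _; rewrite -big_mkcondr /= sumr_const.
by rewrite -scaler_nat natz.
Qed.

(** [push] injects the chains for [A] and [B] into those for [A'] and [B'] and keeps the contributed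
    shapes, so the difference is the sum over the chains outside the image. *)
Lemma schur_positive_diff (A A' B B' : seq nat) m L q s :
    is_part A -> is_part A' -> is_part B -> is_part B' -> 1 < L ->
    size A <= L -> size A' <= L -> size B <= m -> size B' <= m ->
    0 < s -> s.+2 <= nth 0 A 0 -> 0 < q -> q + s.+1 = m ->
    nth 0 A 1 = s -> nth 0 A s = s -> 0 < nth 0 A s.+1 ->
    (forall i, nth 0 A' i = nth 0 A i + (i == 1)) ->
    nth 0 B q = nth 0 B q.-1 -> nth 0 B q.+1 + s <= nth 0 B q ->
    (forall t, nth 0 B' t + (t == q) = nth 0 B t) ->
    nth 0 A 0 <= nth 0 B m.-1 ->
  schur_positive (fun n => schur A' n * schur B' n - schur A n * schur B n)%R.
Proof.
move=> pA pA' pB pB' L1 sA sA' sB sB' s0 sb q0 em A1 As AsS eA eB1 eB2 eB AB.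
(* [A] and [A'] have the same first part, so their chains live in one array type. *)
have L0 := ltnW L1; have m0 : 0 < m by lia.
pose K := nth 0 A 0; have hA : head 0 A <= K by rewrite -nth0.
have A'0 : nth 0 A' 0 = nth 0 A 0 by rewrite eA addn0.
have hA' : head 0 A' <= K by rewrite -nth0 A'0.
have Az i : L <= i -> nth 0 A i = 0 by move=> h; rewrite nth_default ?(leq_trans sA).
have A'z i : L <= i -> nth 0 A' i = 0 by move=> h; rewrite nth_default ?(leq_trans sA').
have AB' : nth 0 A' 0 <= nth 0 B' m.-1.
  by have := eB m.-1; rewrite A'0; move: AB; case: eqP => ?; lia.
pose X := lr_set m L K (nth 0 A) (nth 0 B).
pose X' := lr_set m L K (nth 0 A') (nth 0 B').
pose f (u : array m L K) := mk m L K (push q (pivot (ev u) q s) (ev u)).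
have ez (u : array m L K) t j : L <= j -> ev u t j = 0 by exact: ev_out.
have XP u : X u -> [/\ strips m (ev u), lattice m (nth 0 B) (ev u),
    (forall i, ev u m i = nth 0 A i) & forall i, ev u 0 i.+1 <= ev u 0 i].
  by move=> /andP[/(ev_chainP _ Az)[h1 h2 h3] /(latticeP _ _ L0 (ez u))].
have pushP u : X u -> _ := fun Xu => let: And4 h1 h2 h3 h4 := XP u Xu in
  @push_injection m q s (nth 0 A 0) (ev u) (nth 0 B) (nth 0 B') h1 h2 s0 sb q0 em
    (h3 0) (etrans (h3 1) A1) (etrans (h3 s) As)
    (eq_ind_r (leq 1) AsS (h3 s.+1)) eB1 eB2 eB.
have fE u t i : X u -> t <= m -> ev (f u) t i = push q (pivot (ev u) q s) (ev u) t i.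
  move=> Xu tm; have [p1 p2 p3 p4 p5] := pushP u Xu.
  have [h1 h2 h3 h4] := XP u Xu.
  have [Li|iL] := leqP L i; first by rewrite ev_out // /push ez //; lia.
  rewrite ev_mk //; apply: leq_trans (strips_mono i p1 tm (leqnn m)) _.
  by rewrite p5 h3 -eA /K -A'0 part_mono.
have wE u t l : X u -> t < m ->
    wt (ev (f u)) t l = wt (push q (pivot (ev u) q s) (ev u)) t l.
  by move=> Xu tm; apply: eq_wt => j _; rewrite !fE // ltnW.
have fX u : X u -> X' (f u).
  move=> Xu; have [p1 p2 p3 p4 p5] := pushP u Xu; have [h1 h2 h3 h4] := XP u Xu.
  apply/andP; split.
    apply/(ev_chainP _ A'z); split=> [t i tm|i|i]; rewrite !fE //; try lia.
    - exact: p1.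
    - by rewrite p5 h3 eA.
    - by rewrite !p4.
  by apply/(latticeP _ _ L0 (ez _)) => t i tm; rewrite !wE ?(ltnW tm) //; apply: p2.
have shE u : X u -> lr_shape m L (nth 0 B') (ev (f u)) = lr_shape m L (nth 0 B) (ev u).
  move=> Xu; have [p1 p2 p3 p4 p5] := pushP u Xu.
  congr filter; apply: eq_mkseq => i; rewrite /lr_part.
  by case: ifP => im; [rewrite wE // p3 | rewrite fE // p4].
have fI : {in [set u | X u] &, injective f}.
  move=> u v; rewrite !inE => Xu Xv e; have [h1 h2 h3 _] := XP u Xu.
  have [k1 k2 k3 _] := XP v Xv; apply: ev_inj => t i tm _.
  apply: (@push_inj m q s (ev u) (ev v) (nth 0 B)) => //; rewrite ?h3 ?k3 //.
  by move=> t' i' tm'; rewrite -!fE // e.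
pose Y (u : array m L K) := X' u && (u \notin f @: [set u | X u]).
pose sh (u : array m L K) := lr_shape m L (nth 0 B') (ev u).
have large n : m + L <= n.+1 -> (schur A' n.+1 * schur B' n.+1 -
    schur A n.+1 * schur B n.+1 = \sum_(u | Y u) schur (sh u) n.+1)%R.
  move=> hn; rewrite (schur_mul pA pB L0 m0 sA hA sB AB hn).
  rewrite (schur_mul pA' pB' L0 m0 sA' hA' sB' AB' hn) -/X -/X'.
  rewrite (bigID (fun u => u \in f @: [set u | X u])) /= addrC.
  apply/eqP; rewrite subr_eq; apply/eqP; congr (_ + _)%R.
  rewrite (eq_bigl (fun u => u \in f @: [set u | X u])); last first.
    move=> u /=; rewrite andbC; case: imsetP => //= -[v]; rewrite inE => Xv ->.
    by rewrite fX.
  rewrite (big_imset _ fI) (eq_bigl _ _ (in_set X)).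
  by apply: eq_bigr => u Xu; rewrite shE.
apply: (@schur_positive_sum _ Y sh) => [u /andP[X'u _]|n].
  by apply: part_of_part => i; apply: (lr_part_nonincr i L0 m0 A'z AB' X'u).
have [mn|nm] := leqP (m + L) n.
  by move: mn; case: n => [|n] mn; [lia | exact: large].
(* With fewer variables, the identity is obtained by restriction from [m + L] of them. *)
have E : m + L = (m + L).-1.+1 by lia.
have le : n <= (m + L).-1.+1 by lia.
rewrite -!(schur_restrict _ le) -!rmorphM -rmorphB /= large; last by rewrite -E.
by rewrite raddf_sum; apply: eq_bigr => u _; rewrite /= schur_restrict.
Qed.

(** * Conjugates and complements *)

Lemma is_part_nth la : (forall i, nth 0 la i.+1 <= nth 0 la i) ->
  (forall i, i < size la -> 0 < nth 0 la i) -> is_part la.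
Proof.
move=> d p; apply/andP; split; first by apply/(sortedP 0) => i _; apply: d.
by apply/negP => /(nthP 0)[i /p + e]; rewrite e.
Qed.

Lemma part_gt0 la i : is_part la -> (0 < nth 0 la i) = (i < size la).
Proof.
case/andP => _ nz; case: (ltnP i (size la)) => h; last by rewrite nth_default.
by rewrite lt0n; apply: contra nz => /eqP<-; apply: mem_nth.
Qed.

Lemma nth_part_add a b i : nth 0 (part_add a b) i = nth 0 a i + nth 0 b i.
Proof.
rewrite /part_add; case: (ltnP i (maxn (size a) (size b))) => h.
  by rewrite nth_mkseq.
by rewrite !nth_default ?size_mkseq //; lia.
Qed.

Lemma nth_part_conj la i j : is_part la ->
  (i < nth 0 (part_conj la) j) = (j < nth 0 la i).
Proof.
move=> pla; have cE : nth 0 (part_conj la) j = count (fun i => j < nth 0 la i)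
    (iota 0 (size la)).
  rewrite -(count_map (nth 0 la) (fun p => j < p)) map_nth_iota0 // take_size.
  rewrite /part_conj; case: (ltnP j (head 0 la)) => h; first by rewrite nth_mkseq.
  rewrite nth_default ?size_mkseq //; apply/esym/eqP; rewrite -leqn0 leqNgt -has_count.
  apply/hasPn => p /(nthP 0)[i' _ <-]; rewrite -leqNgt; apply: leq_trans h.
  by rewrite -nth0 part_mono.
rewrite cE; case: (ltnP i (size la)) => h.
  by rewrite count_antitone // => x; have := part_nonincr x pla; lia.
rewrite (nth_default _ h) ltn0; apply/negbTE; rewrite -leqNgt.
by apply: leq_trans (count_size _ _) _; rewrite size_iota.
Qed.

Lemma nth_part_conj_eq la j k : is_part la ->
  (forall i, (i < k) = (j < nth 0 la i)) -> nth 0 (part_conj la) j = k.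
Proof.
move=> pla H; have E i : (i < nth 0 (part_conj la) j) = (i < k).
  by rewrite nth_part_conj.
by have := E k; have := E (nth 0 (part_conj la) j); rewrite !ltnn; lia.
Qed.

Lemma part_conj_part la : is_part la -> is_part (part_conj la).
Proof.
move=> pla; apply: is_part_nth => [j|j].
  rewrite leqNgt; apply/negP => h; move: (h); rewrite nth_part_conj // => h'.
  by have := ltnW h'; rewrite -nth_part_conj // ltnn.
by rewrite size_mkseq nth_part_conj // nth0.
Qed.

Definition compl_fun m (la : seq nat) (r : nat) : nat :=
  if r < m then m - nth 0 la (m - r.+1) else 0.

Lemma part_complE m la : part_compl m la = part_of (compl_fun m la) m.
Proof.
congr filter; apply: (@eq_from_nth _ 0); rewrite size_rev !size_mkseq // => i im.
rewrite nth_rev ?size_mkseq // !nth_mkseq //; last lia.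
by rewrite /compl_fun im.
Qed.

Lemma compl_fun_nonincr m la i : is_part la ->
  compl_fun m la i.+1 <= compl_fun m la i.
Proof.
move=> pla; rewrite /compl_fun; case: (ltnP i.+1 m) => h //; rewrite (ltnW h).
have := part_nonincr (m - i.+2) pla.
have -> : (m - i.+2).+1 = m - i.+1 by lia.
lia.
Qed.

Lemma part_compl_part m la : is_part la -> is_part (part_compl m la).
Proof.
by move=> pla; rewrite part_complE; apply: part_of_part => i; apply: compl_fun_nonincr.
Qed.

Lemma nth_part_compl m la i : is_part la ->
  nth 0 (part_compl m la) i = compl_fun m la i.
Proof.
move=> pla; rewrite part_complE nth_part_of // => j.
  exact: compl_fun_nonincr.
by rewrite /compl_fun ltnNge => ->.
Qed.

Lemma sumn_nth la N : size la <= N -> sumn la = \sum_(i < N) nth 0 la i.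
Proof.
move=> sN; rewrite sumnE (big_nth 0) big_mkord -(subnKC sN) big_split_ord /=.
by rewrite [X in _ + X]big1 ?addn0 // => i _; rewrite nth_default // leq_addr.
Qed.

(** * The covering relation *)

Theorem mainTheorem5 (nu beta : seq nat) (s : nat) (alpha : seq nat)
    (nu_type2 : type2_decomp nu beta s alpha)
    (alpha_len : (size alpha <= s)%N)
    (beta1 : head 0%N beta = 1%N) :
  covers (part_add (part_add beta (rcons (nseq s s) 1%N)) alpha) nu.
Proof.
case: nu_type2 => -[pb pa] s0 a0 sub nuE; set mu := part_add _ _.
pose b := size beta.
have bE i : nth 0 beta i = (i < b).
  have := part_gt0 i pb; have := part_mono pb (leq0n i); rewrite nth0 beta1 /b; lia.
have sb : s.+1 < b.
  have := sub s.+1; rewrite beta1 /stair nth_cat size_nseq ltnn subnn bE /=; lia.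
(* The bound [alpha_len], assumed in addition to the type 2 decomposition, leaves the rows of [nu]
   from index [s] on to [beta] alone. *)
have az i : s <= i -> nth 0 alpha i = 0.
  by move=> h; rewrite nth_default // (leq_trans alpha_len).
have a1 : 0 < nth 0 alpha 0.
  by rewrite part_gt0 //; case: (alpha) a0.
have ad i := part_nonincr i pa.
have nuN i : nth 0 nu i = (i < b) + (if i < s then s else 0) + nth 0 alpha i.
  by rewrite nuE !nth_part_add bE nth_nseq.
have muN i : nth 0 mu i = nth 0 nu i + (i == s).
  rewrite nuN !nth_part_add bE nth_rcons size_nseq nth_nseq.
  by case: (ltngtP i s) => h; lia.
have s_nu : size nu = b by rewrite nuE !size_mkseq size_nseq -/b; lia.
have s_mu : size mu = b by rewrite !size_mkseq size_rcons size_nseq -/b; lia.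
have nud i : nth 0 nu i.+1 <= nth 0 nu i.
  by rewrite !nuN; have := ad i; do 2!case: ifP => ?; lia.
have pnu : is_part nu.
  by apply: is_part_nth => // i; rewrite s_nu nuN; lia.
have pmu : is_part mu.
  apply: is_part_nth => i; last by rewrite s_mu muN nuN; lia.
  rewrite !muN; have [e|ne] := eqVneq i.+1 s; last by have := nud i; lia.
  rewrite !nuN e ltnn az //; case: ifP => ?; lia.
split => //.
- by move=> i; rewrite muN leq_addr.
- rewrite (@sumn_nth mu b) ?s_mu // (@sumn_nth nu b) ?s_nu //.
  rewrite (eq_bigr (fun i : 'I_b => nth 0 nu i + (i == s :> nat))); last first.
    by move=> i _; rewrite muN.
  rewrite big_split /= -addn1; congr (_ + _); have sb' := ltnW sb.
  rewrite (bigD1 (Ordinal sb')) //= eqxx big1 // => i.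
  by rewrite -val_eqE /= => /negPf->.
move=> m; rewrite s_mu -nth0 => hm.
have nu0 : nth 0 nu 0 = s.+1 + nth 0 alpha 0 by rewrite nuN s0; lia.
have mu0 : nth 0 mu 0 = nth 0 nu 0 by rewrite muN; lia.
have nus : nth 0 nu s = 1 by rewrite nuN ltnn az //; lia.
have nus1 : nth 0 nu s.+1 = 1 by rewrite nuN ifF ?az //; lia.
have numax i : nth 0 nu i <= nth 0 nu 0 by rewrite part_mono.
have A1 : nth 0 (part_conj nu) 1 = s.
  by apply: nth_part_conj_eq => // i; rewrite nuN; case: (ltnP i s) => h; [|rewrite az //]; lia.
(* Row [m - s.+1] of the complement faces row [s] of the partition, which receives the new box. *)
apply: (@schur_positive_diff (part_conj nu) (part_conj mu) (part_compl m nu)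
  (part_compl m mu) m (maxn 2 (nth 0 mu 0)) (m - s.+1) s).
- exact: part_conj_part.
- exact: part_conj_part.
- exact: part_compl_part.
- exact: part_compl_part.
- lia.
- by rewrite size_mkseq -nth0; lia.
- by rewrite size_mkseq -nth0; lia.
- by rewrite part_complE size_part_of.
- by rewrite part_complE size_part_of.
- by [].
- rewrite (@nth_part_conj_eq _ _ b) // => i; rewrite nuN.
  by case: (ltnP i s) => h; [|rewrite az //]; lia.
- lia.
- lia.
- exact: A1.
- apply: nth_part_conj_eq => // i; rewrite nuN.
  by case: (ltnP i s) => h; [|rewrite az //]; lia.
(* A nonempty [alpha] makes the first part of [nu] exceed [s + 1]. *)
- by rewrite nth_part_conj // nu0; lia.
- move=> i; apply: nth_part_conj_eq => // x; rewrite muN.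
  have := nth_part_conj x i pnu.
  have [->|ni] := eqVneq i 1.
    by rewrite A1; have [->|nx] := eqVneq x s; [rewrite nus | ]; lia.
  by have [->|nx] := eqVneq x s; [rewrite nus | ]; lia.
(* These rows face the parts of [nu] at indices [s] and [s.+1], both 1 because [beta] has at least
   [s + 2] parts. *)
- rewrite !nth_part_compl // /compl_fun !ifT; try lia.
  have -> : m - (m - s.+1).+1 = s by lia.
  have -> : m - (m - s.+1).-1.+1 = s.+1 by lia.
  by rewrite nus nus1.
- rewrite !nth_part_compl // /compl_fun.
  have -> : m - (m - s.+1).+1 = s by lia.
  rewrite nus !ifT; try lia.
  have -> : m - (m - s.+1).+2 = s.-1 by lia.
  by rewrite nuN ifT; lia.
- move=> t; rewrite !nth_part_compl // /compl_fun muN.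
  have := numax (m - t.+1); case: (ltnP t m) => tm; last lia.
  have [e|ne] := eqVneq t (m - s.+1); last lia.
  have -> : m - t.+1 = s by lia.
  by rewrite eqxx nus; lia.
(* The lower bound on [m] enters: the last row of the complement is [m] minus the first part of
   [nu], hence at least [b]. *)
- rewrite (@nth_part_conj_eq _ _ b) //; last first.
    by move=> i; rewrite nuN; case: (ltnP i s) => h; [|rewrite az //]; lia.
  rewrite nth_part_compl // /compl_fun ifT; last lia.
  have -> : m - m.-1.+1 = 0 by lia.
  lia.
Qed.
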